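(* Let $G$ be a finite graph embedded in $\mathbb R^2$ with straight-line edges, with edge weights $K_{xy}$, and let $C_1,\dots,C_m$ be pairwise edge-disjoint loops in $G$. Then \[ \prod_j(-1)^{\mathrm{si}(C_j)}\prod_{j<k}(-1)^{\mathrm{mi}(C_j,C_k)}\prod_{xy\in\bigcup_jE(C_j)}K_{xy}=\prod_j\Big((-1)^{\tau(C_j)+1}\prod_{xy\in E(C_j)}K_{xy}\Big). \]
   Context: A loop is an equivalence class of closed walks $(\gamma_1,\dots,\gamma_k,\gamma_{k+1}=\gamma_1)$ that are edge-simple (no edge traversed twice), modulo cyclic shifts and reversal. Each passage of a loop through a vertex $v$ uses an unordered pair of edges at $v$ (a transition). Two transitions $\{e_1,e_2\},\{h_1,h_2\}$ at $v$ cross if $e_1<h_1<e_2<h_2$ in the counterclockwise cyclic order of edges around $v$. $\mathrm{si}(C)$ is the number of crossing pairs of transitions both belonging to $C$ (over all vertices); $\mathrm{mi}(C,C')$ is the number of crossing pairs with one transition from $C$ and one from $C'$. The turning number of a loop is $\tau(C)=\frac1{2\pi}\sum_{j=1}^k\theta_j \bmod 2$, where $\theta_j$ is the exterior (turning) angle of the polygonal path at $\gamma_{j+1}$ between segments $\gamma_j\gamma_{j+1}$ and $\gamma_{j+1}\gamma_{j+2}$. *)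

(* Defs.v *)
From Stdlib Require Import Reals Lra Lia ZArith Arith List Bool.
Import ListNotations.
Open Scope R_scope.
Open Scope bool_scope.

Definition pt := (R * R)%type.
Definition vsub (p q : pt) : pt := (fst p - fst q, snd p - snd q).
Definition cross (u w : pt) : R := fst u * snd w - snd u * fst w.
Definition dot (u w : pt) : R := fst u * fst w + snd u * snd w.

(** [atan2 y x]: the argument in (-PI, PI] of the vector (x, y)
    (standard two-argument arctangent; value 0 for the zero vector). *)
Definition atan2 (y x : R) : R :=
  if Rlt_dec 0 x then atan (y / x)
  else if Rlt_dec x 0 then
         (if Rle_dec 0 y then atan (y / x) + PI else atan (y / x) - PI)
  else if Rlt_dec 0 y then PI / 2
  else if Rlt_dec y 0 then - (PI / 2)
  else 0.

Definition signed_angle (u w : pt) : R := atan2 (cross u w) (dot u w).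

Definition ccw_angle (u w : pt) : R :=
  let a := signed_angle u w in if Rlt_dec a 0 then a + 2 * PI else a.

Definition on_segment (z p q : pt) : Prop :=
  exists t, 0 <= t <= 1 /\ z = (fst p + t * (fst q - fst p), snd p + t * (snd q - snd p)).

(** Vertices are [0 .. n-1], [pos v] is the position of vertex [v] in R^2,
    and [E] is the (undirected) adjacency relation; the edge [xy] is the
    straight segment [pos x, pos y]. *)
Definition straight_line_embedded (n : nat) (pos : nat -> pt) (E : nat -> nat -> Prop) : Prop :=
  (forall x y, E x y -> (x < n)%nat /\ (y < n)%nat) /\
  (forall x y, E x y -> E y x) /\
  (forall x, ~ E x x) /\
  (forall x y, (x < n)%nat -> (y < n)%nat -> pos x = pos y -> x = y) /\
  (forall v a b, (v < n)%nat -> E a b -> on_segment (pos v) (pos a) (pos b) -> v = a \/ v = b) /\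
  (forall a b c d z, E a b -> E c d -> ~ ((a = c /\ b = d) \/ (a = d /\ b = c)) ->
      on_segment z (pos a) (pos b) -> on_segment z (pos c) (pos d) ->
      (z = pos a \/ z = pos b) /\ (z = pos c \/ z = pos d)).

(** A loop is represented by a closed walk [g = [γ_1; ...; γ_k]] with the
    convention γ_{k+1} = γ_1 (indices are taken cyclically). *)
Definition cnth (g : list nat) (i : nat) : nat := nth (i mod length g) g 0%nat.

(** Undirected edge {a, b} encoded as the ordered pair (min, max). *)
Definition ekey (a b : nat) : nat * nat := (Nat.min a b, Nat.max a b).

Definition ekey_eq_dec : forall x y : nat * nat, {x = y} + {x <> y}.
Proof. decide equality; apply Nat.eq_dec. Defined.

Definition loop_edges (g : list nat) : list (nat * nat) :=
  map (fun i => ekey (cnth g i) (cnth g (S i))) (seq 0 (length g)).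

Definition is_loop (E : nat -> nat -> Prop) (g : list nat) : Prop :=
  g <> [] /\
  (forall i, (i < length g)%nat -> E (cnth g i) (cnth g (S i))) /\
  NoDup (loop_edges g).

Definition pairwise_edge_disjoint (Cs : list (list nat)) : Prop :=
  forall j k, (j < length Cs)%nat -> (k < length Cs)%nat -> j <> k ->
    forall e, In e (loop_edges (nth j Cs [])) -> ~ In e (loop_edges (nth k Cs [])).

(** The passage of the loop through γ_{i+1} uses the transition at vertex
    v = γ_{i+1} consisting of the edges v γ_i and v γ_{i+2}; it is encoded
    as (v, (γ_i, γ_{i+2})), an edge at v being identified with its other endpoint. *)
Definition transitions (g : list nat) : list (nat * (nat * nat)) :=
  map (fun i => (cnth g (S i), (cnth g i, cnth g (S (S i))))) (seq 0 (length g)).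

Definition ccw_between (pos : nat -> pt) (v x y z : nat) : bool :=
  let d := fun w => vsub (pos w) (pos v) in
  if Rlt_dec 0 (ccw_angle (d x) (d y)) then
    if Rlt_dec (ccw_angle (d x) (d y)) (ccw_angle (d x) (d z)) then true else false
  else false.

(** e1 < h1 < e2 < h2 in the counterclockwise cyclic order around v. *)
Definition cyc4 (pos : nat -> pt) (v e1 h1 e2 h2 : nat) : bool :=
  ccw_between pos v e1 h1 e2 && ccw_between pos v e2 h2 e1.

Definition trans_cross (pos : nat -> pt) (t s : nat * (nat * nat)) : bool :=
  let '(v, (a, b)) := t in
  let '(w, (c, d)) := s in
  Nat.eqb v w &&
  (cyc4 pos v a c b d || cyc4 pos v a d b c || cyc4 pos v b c a d || cyc4 pos v b d a c).

Definition si (pos : nat -> pt) (g : list nat) : nat :=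
  let T := transitions g in
  length (filter (fun ij => (Nat.ltb (fst ij) (snd ij)) &&
                            trans_cross pos (nth (fst ij) T (0,(0,0))%nat)
                                            (nth (snd ij) T (0,(0,0))%nat))
            (list_prod (seq 0 (length T)) (seq 0 (length T)))).

Definition mi (pos : nat -> pt) (g h : list nat) : nat :=
  length (filter (fun ts => trans_cross pos (fst ts) (snd ts))
            (list_prod (transitions g) (transitions h))).

(** Sum of the exterior (turning) angles θ_j at γ_{j+1}, between segments
    γ_j γ_{j+1} and γ_{j+1} γ_{j+2}, j = 1..k.  The turning number is
    τ(C) = (1/2π) * turning_sum mod 2. *)
Definition turning_sum (pos : nat -> pt) (g : list nat) : R :=
  fold_right Rplus 0
    (map (fun i => signed_angle (vsub (pos (cnth g (S i))) (pos (cnth g i)))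
                                (vsub (pos (cnth g (S (S i)))) (pos (cnth g (S i)))))
         (seq 0 (length g))).

Definition Rprod (l : list R) : R := fold_right Rmult 1 l.

Definition weight_prod (K : nat -> nat -> R) (es : list (nat * nat)) : R :=
  Rprod (map (fun e => K (fst e) (snd e)) es).

Definition union_edges (Cs : list (list nat)) : list (nat * nat) :=
  nodup ekey_eq_dec (flat_map loop_edges Cs).

(* Main.v *)
Require Import Defs.
From Stdlib Require Import Reals Lra Lia ZArith Arith List Bool Psatz Btauto.
Import ListNotations.
Open Scope R_scope.

(** After a similarity of the plane no two vertices have the same height, so no edge is horizontal
    and any two edges with overlapping ranges of heights are ordered from left to right on the
    overlap.  Crossings occur at vertices only, hence this order is the same at the top and at the
    bottom of the overlap.  Sum these comparisons modulo 2 over all pairs of edges of a loop [C].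
    A comparison at a vertex in the interior of the range of the other edge occurs twice, once for
    each of the two edges of [C] at that vertex, and cancels.  At a vertex shared by two passages
    the comparisons of edges on the same side of the horizontal line add up to the crossing
    indicator of the two transitions.  A single passage contributes only at a local extremum of the
    height, by the order of its two edges: these contributions count the turns of [C] through the
    direction [(-1, 0)], whose parity is that of tau(C).  The choice of a starting point costs one
    correction, because a closed curve meets a horizontal line an even number of times; whence
    si(C) = tau(C) + 1 modulo 2.  For two edge-disjoint loops the same sum, over pairs with one edge
    in each, gives that mi(C, C') is even. *)

(** * Sums modulo 2 *)

Fixpoint xsum (n : nat) (f : nat -> bool) : bool :=
  match n with O => false | S m => xorb (xsum m f) (f m) end.

Definition xtri (n : nat) (F : nat -> nat -> bool) : bool :=
  xsum n (fun j => xsum j (fun i => F i j)).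

Definition xlist {A : Type} (l : list A) (f : A -> bool) : bool :=
  fold_right (fun a b => xorb (f a) b) false l.

Lemma xsum_ext n f g : (forall i, (i < n)%nat -> f i = g i) -> xsum n f = xsum n g.
Proof.
  induction n as [|n IH]; intros H; simpl; auto.
  rewrite IH, H; auto.
Qed.

Lemma xsum_false n f : (forall i, (i < n)%nat -> f i = false) -> xsum n f = false.
Proof.
  intros H. rewrite (xsum_ext n f (fun _ => false) H). clear H.
  induction n; simpl; [|rewrite IHn]; reflexivity.
Qed.

Lemma xsum_xorb n f g :
  xsum n (fun i => xorb (f i) (g i)) = xorb (xsum n f) (xsum n g).
Proof.
  induction n as [|n IH]; simpl; auto. rewrite IH. btauto.
Qed.

Lemma xsum_head n f : xsum (S n) f = xorb (f 0%nat) (xsum n (fun i => f (S i))).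
Proof.
  induction n as [|n IH]; simpl in *; [btauto|]. rewrite IH. btauto.
Qed.

Lemma xsum_shift n f : f n = f 0%nat -> xsum n (fun i => f (S i)) = xsum n f.
Proof.
  intros H. pose proof (xsum_head n f) as E. simpl in E. rewrite H in E.
  destruct (xsum n f), (f 0%nat), (xsum n (fun i => f (S i))); simpl in *; congruence.
Qed.

Lemma xsum_telescope n f :
  xsum n (fun i => xorb (f i) (f (S i))) = xorb (f 0%nat) (f n).
Proof.
  induction n as [|n IH]; simpl; [btauto|]. rewrite IH. btauto.
Qed.

Lemma xsum_cyclic n f :
  f n = f 0%nat -> xsum n (fun i => xorb (f i) (f (S i))) = false.
Proof. intros H. rewrite xsum_telescope, H. btauto. Qed.

Lemma xsum_exchange m n (F : nat -> nat -> bool) :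
  xsum m (fun i => xsum n (fun j => F i j)) = xsum n (fun j => xsum m (fun i => F i j)).
Proof.
  induction m as [|m IH]; simpl.
  - symmetry. apply xsum_false. auto.
  - rewrite IH, <- xsum_xorb. reflexivity.
Qed.

Lemma xtri_ext n F G :
  (forall i j, (i < j < n)%nat -> F i j = G i j) -> xtri n F = xtri n G.
Proof.
  intros H. apply xsum_ext. intros j Hj. apply xsum_ext. intros i Hi. apply H. lia.
Qed.

Lemma xtri_xorb n F G :
  xtri n (fun i j => xorb (F i j) (G i j)) = xorb (xtri n F) (xtri n G).
Proof.
  unfold xtri. rewrite <- xsum_xorb. apply xsum_ext. intros j _. apply xsum_xorb.
Qed.

(** Off the diagonal every unordered pair of indices occurs in both orders. A symmetrised triangular
    sum can thus be traded for a square one, where cancellation around a cycle is available. *)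
Lemma xsum_square n F :
  xsum n (fun i => xsum n (fun j => F i j)) =
  xorb (xtri n (fun i j => xorb (F i j) (F j i))) (xsum n (fun i => F i i)).
Proof.
  unfold xtri. induction n as [|n IH]; [reflexivity|].
  simpl. rewrite (xsum_xorb n (fun i => xsum n (fun j => F i j)) (fun i => F i n)), IH.
  rewrite (xsum_xorb n (fun i => F i n) (fun i => F n i)).
  btauto.
Qed.

(** A triangular sum is not invariant under cyclic shifts; this lemma and the next two record the
    rows, columns and diagonals gained or lost. Here the shifted pairs, completed by the vanishing
    terms next to the diagonal, fill the triangle of size [S n]. *)
Lemma xtri_shift_right n F :
  (forall j, F j (S j) = false) ->
  xtri n (fun i j => F i (S j)) = xorb (xtri n F) (xsum n (fun i => F i n)).
Proof.
  intros H. unfold xtri.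
  change (xorb (xsum n (fun j => xsum j (fun i => F i j))) (xsum n (fun i => F i n)))
    with (xsum (S n) (fun j => xsum j (fun i => F i j))).
  rewrite xsum_head. cbn [xsum]. rewrite xorb_false_l. apply xsum_ext. intros j _.
  rewrite H. symmetry. apply xorb_false_r.
Qed.

Lemma xtri_shift_left n F :
  xtri n (fun i j => F (S i) j) =
  xorb (xorb (xtri n F) (xsum n (fun j => F j j))) (xsum n (fun j => F 0%nat j)).
Proof.
  unfold xtri. rewrite <- !xsum_xorb. apply xsum_ext. intros j _.
  pose proof (xsum_head j (fun i => F i j)) as E. simpl in E. rewrite E. btauto.
Qed.

Lemma xtri_shift_both n F :
  (forall i, F i n = F i 0%nat) ->
  xtri n (fun i j => F (S i) (S j)) =
  xorb (xtri n F) (xsum n (fun i => xorb (F i 0%nat) (F 0%nat i))).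
Proof.
  intros H.
  assert (E : xtri n (fun i j => F (S i) (S j)) =
    xorb (xsum (S n) (fun j => xsum j (fun i => F i j))) (xsum n (fun j => F 0%nat (S j)))).
  { rewrite xsum_head. cbn [xsum]. rewrite xorb_false_l. unfold xtri. rewrite <- xsum_xorb.
    apply xsum_ext. intros j _.
    pose proof (xsum_head j (fun i => F i (S j))) as E. simpl in E. rewrite E. btauto. }
  rewrite E. simpl. rewrite (xsum_shift n (fun j => F 0%nat j)) by (simpl; auto).
  rewrite (xsum_xorb n (fun i => F i 0%nat) (fun i => F 0%nat i)).
  rewrite (xsum_ext n (fun i => F i n) (fun i => F i 0%nat)) by auto.
  unfold xtri. btauto.
Qed.

Lemma xlist_map {A B} (h : A -> B) l f : xlist (map h l) f = xlist l (fun a => f (h a)).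
Proof. induction l; simpl; congruence. Qed.

Lemma xlist_app {A} (l l' : list A) f : xlist (l ++ l') f = xorb (xlist l f) (xlist l' f).
Proof.
  induction l; simpl; [symmetry; apply xorb_false_l|]. rewrite IHl. btauto.
Qed.

Lemma xlist_prod {A B} (l : list A) (l' : list B) f :
  xlist (list_prod l l') f = xlist l (fun a => xlist l' (fun b => f (a, b))).
Proof.
  induction l; simpl; auto. rewrite xlist_app, IHl, xlist_map. reflexivity.
Qed.

Lemma xlist_seq n f : xlist (seq 0 n) f = xsum n f.
Proof.
  induction n; auto. rewrite seq_S, xlist_app, IHn. simpl. rewrite xorb_false_r. reflexivity.
Qed.

Lemma odd_length_filter {A} (f : A -> bool) l : Nat.odd (length (filter f l)) = xlist l f.
Proof.
  induction l as [|a l IH]; auto. simpl. rewrite <- IH.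
  destruct (f a); simpl length; [|rewrite xorb_false_l; auto].
  rewrite Nat.odd_succ, <- Nat.negb_odd. destruct (Nat.odd _); reflexivity.
Qed.

Lemma xsum_lt_xtri n F :
  xsum n (fun i => xsum n (fun j => Nat.ltb i j && F i j)) = xtri n F.
Proof.
  rewrite (xsum_square n (fun i j => Nat.ltb i j && F i j)).
  rewrite (xsum_false n (fun i => _ && _)) by (intros; rewrite Nat.ltb_irrefl; reflexivity).
  rewrite xorb_false_r. apply xtri_ext. intros i j H.
  rewrite (proj2 (Nat.ltb_lt i j)), (proj2 (Nat.ltb_ge j i)) by lia.
  simpl. apply xorb_false_r.
Qed.

(** * Two edges meeting at most at their ends *)

Definition ltb (x y : R) : bool := if Rlt_dec x y then true else false.
Definition eqh (p q : pt) : bool := if Req_EM_T (snd p) (snd q) then true else false.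

Lemma ltb_true x y : x < y -> ltb x y = true.
Proof. unfold ltb. destruct (Rlt_dec x y); auto; lra. Qed.
Lemma ltb_false x y : y <= x -> ltb x y = false.
Proof. unfold ltb. destruct (Rlt_dec x y); auto; lra. Qed.

Definition height_between (v c d : pt) : bool :=
  ltb (snd c) (snd v) && ltb (snd v) (snd d) || ltb (snd d) (snd v) && ltb (snd v) (snd c).

Definition right_of (v c d : pt) : bool :=
  ltb (snd c) (snd v) && ltb (snd v) (snd d) && ltb (cross (vsub d c) (vsub v c)) 0 ||
  ltb (snd d) (snd v) && ltb (snd v) (snd c) && ltb 0 (cross (vsub d c) (vsub v c)).

(* False unless both directions point strictly above, or both strictly below, the horizontal. *)
Definition dir_right (u w : pt) : bool :=
  ltb 0 (snd u) && ltb 0 (snd w) && ltb 0 (cross u w) ||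
  ltb (snd u) 0 && ltb (snd w) 0 && ltb (cross u w) 0.

(** Coincidence of the two vertices is tested by height, which suffices once equal heights occur
    only at equal points. *)
Definition ray_right (v x w y : pt) : bool := eqh v w && dir_right (vsub x v) (vsub y w).

Definition meet_at_ends (a b c d : pt) : Prop :=
  (forall z, on_segment z a b -> on_segment z c d -> (z = a \/ z = b) /\ (z = c \/ z = d)) /\
  ~ (a = c /\ b = d) /\ ~ (a = d /\ b = c).

Lemma on_segment_sym z p q : on_segment z p q -> on_segment z q p.
Proof.
  intros (t & Ht & ->). exists (1 - t). split; [lra|]. f_equal; ring.
Qed.

Lemma meet_at_ends_flip_l a b c d : meet_at_ends a b c d -> meet_at_ends b a c d.
Proof.
  intros (H & H1 & H2). split; [|tauto].
  intros z Hz Hz'. destruct (H z (on_segment_sym _ _ _ Hz) Hz'). tauto.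
Qed.

Lemma meet_at_ends_flip_r a b c d : meet_at_ends a b c d -> meet_at_ends a b d c.
Proof.
  intros (H & H1 & H2). split; [|tauto].
  intros z Hz Hz'. destruct (H z Hz (on_segment_sym _ _ _ Hz')). tauto.
Qed.

Lemma meet_at_ends_sym a b c d : meet_at_ends a b c d -> meet_at_ends c d a b.
Proof.
  intros (H & H1 & H2). split; [|split; intros [-> ->]; tauto].
  intros z Hz Hz'. destruct (H z Hz' Hz). tauto.
Qed.

Lemma right_of_flip v c d : right_of v c d = right_of v d c.
Proof.
  unfold right_of.
  replace (cross (vsub c d) (vsub v d)) with (- cross (vsub d c) (vsub v c))
    by (unfold cross, vsub; simpl; ring).
  set (k := cross _ _). unfold ltb.
  destruct (Rlt_dec k 0), (Rlt_dec 0 k), (Rlt_dec (-k) 0), (Rlt_dec 0 (-k)); try lra; btauto.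
Qed.

Lemma height_between_flip v c d : height_between v c d = height_between v d c.
Proof. unfold height_between. btauto. Qed.

(* The comparisons of [ab] and [cd] at the ends of their common range of heights, all brought to
   the form "[ab] is right of [cd]": for an end of [cd] this is the negation of [right_of], which
   adds the [height_between] terms. *)
Definition pair_events (a b c d : pt) : bool :=
  xorb (xorb (xorb (right_of a c d) (right_of b c d)) (xorb (right_of c a b) (right_of d a b)))
  (xorb (xorb (height_between c a b) (height_between d a b))
        (xorb (xorb (ray_right a b c d) (ray_right a b d c))
              (xorb (ray_right b a c d) (ray_right b a d c)))).

(* The horizontal distance of the lines [ab] and [cd] at height [y], multiplied by
   [(snd b - snd a) * (snd d - snd c)] to avoid divisions. *)
Definition gap (a b c d : pt) (y : R) : R :=
  (fst a * (snd b - snd a) + (y - snd a) * (fst b - fst a)) * (snd d - snd c) -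
  (fst c * (snd d - snd c) + (y - snd c) * (fst d - fst c)) * (snd b - snd a).

(** At a zero of the gap inside both ranges of heights, the edges would share a point that is not an
    end of [ab]. *)
Lemma gap_nonzero a b c d y :
  meet_at_ends a b c d -> snd a < y < snd b -> snd c < y < snd d -> gap a b c d y <> 0.
Proof.
  intros (H & _) Hab Hcd E. unfold gap in E.
  set (x := fst a + (y - snd a) / (snd b - snd a) * (fst b - fst a)).
  assert (E' : x = fst c + (y - snd c) / (snd d - snd c) * (fst d - fst c)).
  { unfold x. apply (Rmult_eq_reg_r ((snd b - snd a) * (snd d - snd c)));
      [|apply Rmult_integral_contrapositive_currified; lra].
    field_simplify; lra. }
  destruct (H (x, y)) as [[Hz | Hz] _].
  - exists ((y - snd a) / (snd b - snd a)). split.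
    + split; [apply Rle_mult_inv_pos; lra|]. apply Rmult_le_reg_r with (snd b - snd a); [lra|].
      field_simplify; lra.
    + unfold x. f_equal. field. lra.
  - exists ((y - snd c) / (snd d - snd c)). split.
    + split; [apply Rle_mult_inv_pos; lra|]. apply Rmult_le_reg_r with (snd d - snd c); [lra|].
      field_simplify; lra.
    + rewrite E'. f_equal. field. lra.
  - rewrite <- Hz in Hab. simpl in Hab. lra.
  - rewrite <- Hz in Hab. simpl in Hab. lra.
Qed.

(** The gap is affine in the height, so values of opposite sign would force a zero strictly in
    between, which [gap_nonzero] excludes. The heights [y1] and [y2] themselves may be those of
    ends. *)
Lemma gap_sign a b c d y1 y2 :
  meet_at_ends a b c d ->
  snd a <= y1 -> snd c <= y1 -> y1 < y2 -> y2 <= snd b -> y2 <= snd d ->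
  0 <= gap a b c d y1 * gap a b c d y2.
Proof.
  intros M Ha Hc H12 Hb Hd.
  destruct (Rle_dec 0 (gap a b c d y1 * gap a b c d y2)) as [|N]; auto. exfalso.
  set (g1 := gap a b c d y1) in *. set (g2 := gap a b c d y2) in *.
  assert (g1 <> g2) by nra.
  (* The affine function with values [g1] at [y1] and [g2] at [y2] vanishes at this fraction of the
     interval. *)
  set (t := g1 / (g1 - g2)).
  assert (Ht : t * (g1 - g2) = g1) by (unfold t; field; lra).
  assert (0 < t < 1) by (split; destruct (Rlt_dec 0 g1); nra).
  set (y := y1 + t * (y2 - y1)).
  assert (y1 < y < y2) by (unfold y; split; nra).
  apply (gap_nonzero a b c d y M); try lra.
  replace (gap a b c d y) with (g1 - t * (g1 - g2)); [lra|].
  unfold g1, g2, y, gap. ring.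
Qed.

(** If the gap vanished there, the end of [ab] would lie on [cd] strictly between the heights of its
    ends: a common point that is not an end of [cd]. *)
Lemma endpoint_gap_nonzero a b c d :
  meet_at_ends a b c d -> snd a < snd b -> snd c < snd d ->
  (snd c < snd a < snd d -> gap a b c d (snd a) <> 0) /\
  (snd c < snd b < snd d -> gap a b c d (snd b) <> 0).
Proof.
  intros (H & _) Hab Hcd.
  assert (K : forall v, on_segment v a b -> snd c < snd v < snd d ->
    cross (vsub d c) (vsub v c) <> 0).
  { intros v Hv Hcv E. unfold cross, vsub in E; simpl in E.
    destruct (H v) as [_ [-> | ->]]; auto; try lra.
    exists ((snd v - snd c) / (snd d - snd c)). split.
    - split; [apply Rle_mult_inv_pos; lra|]. apply Rmult_le_reg_r with (snd d - snd c); [lra|].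
      field_simplify; lra.
    - destruct v as [x y]; simpl in *. f_equal; field_simplify_eq; lra. }
  split; intros Hv E.
  - apply (K a); auto.
    + exists 0. split; [lra|]. destruct a; simpl; f_equal; ring.
    + unfold gap in E. unfold cross, vsub; simpl. apply (Rmult_eq_reg_r (snd b - snd a)); lra.
  - apply (K b); auto.
    + exists 1. split; [lra|]. destruct b; simpl; f_equal; ring.
    + unfold gap in E. unfold cross, vsub; simpl. apply (Rmult_eq_reg_r (snd b - snd a)); lra.
Qed.

Ltac split_ltb :=
  repeat match goal with |- context [ltb ?x ?y] =>
    first [ rewrite (ltb_true x y) by lra | rewrite (ltb_false x y) by lra
          | let H := fresh in destruct (Rlt_dec x y) as [H|H];
            [rewrite (ltb_true x y H) | rewrite (ltb_false x y (Rnot_lt_le _ _ H))] ] end.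

Lemma eqh_refl p : eqh p p = true.
Proof. unfold eqh. destruct (Req_EM_T _ _); auto; lra. Qed.
Lemma eqh_false p q : snd p <> snd q -> eqh p q = false.
Proof. unfold eqh. destruct (Req_EM_T _ _); auto; lra. Qed.

Ltac finish := split_ltb; first [reflexivity | exfalso; lra].

Lemma same_sign k l x y :
  0 < k -> 0 < l -> 0 <= (k * x) * (l * y) -> k * x <> 0 -> l * y <> 0 ->
  0 < x /\ 0 < y \/ x < 0 /\ y < 0.
Proof.
  intros Hk Hl H Hx Hy.
  assert (x <> 0) by (intros ->; lra). assert (y <> 0) by (intros ->; lra).
  assert (0 < k * l) by nra.
  assert (0 <= x * y) by (apply (Rmult_le_reg_l (k * l)); nra).
  destruct (Rlt_dec 0 x); [left|right]; split; nra.
Qed.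

(** If the ranges of heights overlap in an interval, exactly one comparison is made at each end of
    it, and the two agree because the gap cannot change sign. If the ranges are disjoint or only
    touch, every term is false. *)
Lemma pair_events_up a b c d :
  snd a < snd b -> snd c < snd d ->
  (snd a = snd c -> a = c) -> (snd a = snd d -> a = d) ->
  (snd b = snd c -> b = c) -> (snd b = snd d -> b = d) ->
  meet_at_ends a b c d -> pair_events a b c d = false.
Proof.
  intros Hab Hcd Eac Ead Ebc Ebd M.
  pose proof (gap_sign a b c d) as G.
  (* At each of the four ends the gap is a positive multiple of the cross product tested by
     [right_of], up to sign. *)
  assert (Ga : gap a b c d (snd a) = (snd b - snd a) * - cross (vsub d c) (vsub a c))
    by (unfold gap, cross, vsub; simpl; ring).
  assert (Gb : gap a b c d (snd b) = (snd b - snd a) * - cross (vsub d c) (vsub b c))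
    by (unfold gap, cross, vsub; simpl; ring).
  assert (Gc : gap a b c d (snd c) = (snd d - snd c) * cross (vsub b a) (vsub c a))
    by (unfold gap, cross, vsub; simpl; ring).
  assert (Gd : gap a b c d (snd d) = (snd d - snd c) * cross (vsub b a) (vsub d a))
    by (unfold gap, cross, vsub; simpl; ring).
  destruct (endpoint_gap_nonzero a b c d M Hab Hcd) as [Na Nb].
  destruct (endpoint_gap_nonzero c d a b (meet_at_ends_sym _ _ _ _ M) Hcd Hab) as [Nc Nd].
  assert (Gsw : forall y, gap c d a b y = - gap a b c d y) by (intros; unfold gap; ring).
  rewrite Gsw in Nc, Nd.
  unfold pair_events, right_of, height_between, ray_right, dir_right.
  cbn [snd vsub].
  (* All relative orders of the four heights are enumerated. Equal heights identify points, and
     sharing both ends is excluded by [M]. *)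
  destruct (Rtotal_order (snd a) (snd c)) as [Hac|[Hac|Hac]];
  destruct (Rtotal_order (snd b) (snd d)) as [Hbd|[Hbd|Hbd]];
  destruct (Rtotal_order (snd a) (snd d)) as [Had|[Had|Had]];
  destruct (Rtotal_order (snd b) (snd c)) as [Hbc|[Hbc|Hbc]]; try lra;
  try (specialize (Eac Hac); subst c); try (specialize (Ebd Hbd); subst d);
  try (specialize (Ead Had); subst d); try (specialize (Ebc Hbc); subst c);
  try (exfalso; apply (proj1 (proj2 M)); auto; fail);
  rewrite ?eqh_refl; rewrite ?eqh_false by lra.
  all: repeat match goal with |- context [ltb ?x ?y] =>
    lazymatch x with context [cross] => fail | _ => idtac end;
    lazymatch y with context [cross] => fail | _ => idtac end;
    first [ rewrite (ltb_true x y) by (clear - Hab Hcd Hac Hbd Had Hbc; lra)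
          | rewrite (ltb_false x y) by (clear - Hab Hcd Hac Hbd Had Hbc; lra)] end.
  all: cbn [andb orb]; rewrite ?orb_false_r, ?andb_true_r.
  all: try reflexivity.
  (* What remains are the overlaps of positive length. Without a shared end, [gap_sign] relates the
     comparisons at the two ends of the overlap; with a shared end, both comparisons test the same
     cross product up to sign. *)
  - assert (K := G (snd c) (snd b) M).
    rewrite ?Gb, ?Gc in K; rewrite ?Gb, ?Gc in Nb; rewrite ?Gb, ?Gc in Nc.
    destruct (same_sign (snd d - snd c) (snd b - snd a) _ _ ltac:(lra) ltac:(lra)
      ltac:(apply K; lra) ltac:(lra) ltac:(lra)); finish.
  - replace (cross (vsub a b) (vsub c b)) with (- cross (vsub b a) (vsub c a))
      by (unfold cross, vsub; simpl; ring).
    assert (cross (vsub b a) (vsub c a) <> 0) by (intros E; rewrite Gc, E in Nc; lra).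
    finish.
  - assert (K := G (snd c) (snd d) M).
    rewrite ?Gc, ?Gd in K; rewrite ?Gc, ?Gd in Nc; rewrite ?Gc, ?Gd in Nd.
    destruct (same_sign (snd d - snd c) (snd d - snd c) _ _ ltac:(lra) ltac:(lra)
      ltac:(apply K; lra) ltac:(lra) ltac:(lra)); finish.
  - replace (cross (vsub d a) (vsub b a)) with (- cross (vsub b a) (vsub d a))
      by (unfold cross, vsub; simpl; ring).
    finish.
  - assert (cross (vsub b a) (vsub d a) <> 0) by (intros E; rewrite Gd, E in Nd; lra).
    finish.
  - assert (K := G (snd a) (snd b) M).
    rewrite ?Ga, ?Gb in K; rewrite ?Ga, ?Gb in Na; rewrite ?Ga, ?Gb in Nb.
    destruct (same_sign (snd b - snd a) (snd b - snd a) _ _ ltac:(lra) ltac:(lra)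
      ltac:(apply K; lra) ltac:(lra) ltac:(lra)); finish.
  - replace (cross (vsub a b) (vsub c b)) with (cross (vsub b c) (vsub a c))
      by (unfold cross, vsub; simpl; ring).
    finish.
  - assert (K := G (snd a) (snd d) M).
    rewrite ?Ga, ?Gd in K; rewrite ?Ga, ?Gd in Na; rewrite ?Ga, ?Gd in Nd.
    destruct (same_sign (snd b - snd a) (snd d - snd c) _ _ ltac:(lra) ltac:(lra)
      ltac:(apply K; lra) ltac:(lra) ltac:(lra)); finish.
Qed.

Lemma pair_events_flip_l a b c d : pair_events a b c d = pair_events b a c d.
Proof.
  unfold pair_events. rewrite (right_of_flip c a b), (right_of_flip d a b),
    (height_between_flip c a b), (height_between_flip d a b). btauto.
Qed.

Lemma pair_events_flip_r a b c d : pair_events a b c d = pair_events a b d c.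
Proof.
  unfold pair_events. rewrite (right_of_flip a c d), (right_of_flip b c d). btauto.
Qed.

Lemma pair_events_even a b c d :
  snd a <> snd b -> snd c <> snd d ->
  (snd a = snd c -> a = c) -> (snd a = snd d -> a = d) ->
  (snd b = snd c -> b = c) -> (snd b = snd d -> b = d) ->
  meet_at_ends a b c d -> pair_events a b c d = false.
Proof.
  intros Hab Hcd ? ? ? ? M.
  (* Swapping the ends of either edge does not change the sum, so both edges may be taken to point
     upwards. *)
  destruct (Rdichotomy _ _ Hab) as [Hab'|Hab'], (Rdichotomy _ _ Hcd) as [Hcd'|Hcd'];
    [ | rewrite pair_events_flip_r | rewrite pair_events_flip_l
      | rewrite pair_events_flip_l, pair_events_flip_r ];
    apply pair_events_up; auto;
    auto using meet_at_ends_flip_l, meet_at_ends_flip_r.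
Qed.

(* If the cross product vanished, the shorter of the two edges would lie on the longer one. *)
Lemma cross_nonzero v x y :
  meet_at_ends v x v y -> snd x <> snd v -> 0 < (snd x - snd v) * (snd y - snd v) ->
  cross (vsub x v) (vsub y v) <> 0.
Proof.
  intros M Hx Hs E.
  assert (K : forall p q, meet_at_ends v p v q -> snd p <> snd v ->
     0 < (snd p - snd v) * (snd q - snd v) ->
     (snd p - snd v) * (snd p - snd v) <= (snd p - snd v) * (snd q - snd v) ->
     cross (vsub p v) (vsub q v) = 0 -> False).
  { clear. intros p q (H & H1 & H2) Hp Hs Hle E.
    unfold cross, vsub in E; simpl in E.
    assert (Hq : snd q - snd v <> 0) by (intros K; rewrite K in Hs; lra).
    destruct (H p) as [_ [Hz|Hz]].
    - exists 1. split; [lra|]. destruct p; simpl; f_equal; ring.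
    - set (t := (snd p - snd v) / (snd q - snd v)).
      assert (Ht : t * (snd q - snd v) = snd p - snd v) by (unfold t; field; auto).
      exists t. split.
      + set (s := snd q - snd v) in *. rewrite <- Ht in Hs, Hle.
        assert (0 < s * s) by nra.
        split; nra.
      + destruct p as [px py]; simpl in *. f_equal; [|lra].
        apply (Rmult_eq_reg_r (snd q - snd v)); auto. nra.
    - subst p; lra.
    - subst p; tauto. }
  destruct (Rle_dec ((snd x - snd v) * (snd x - snd v)) ((snd x - snd v) * (snd y - snd v))).
  - apply (K x y); auto.
  - apply (K y x); auto using meet_at_ends_sym.
    + intros F. rewrite F in Hs. lra.
    + lra.
    + nra.
    + rewrite <- Ropp_0, <- E. unfold cross. ring.
Qed.

(** * Arguments and cyclic order *)

Definition arg (u : pt) : R := atan2 (snd u) (fst u).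

Ltac case_dec := repeat match goal with
  | |- context [Rle_dec ?a ?b] => destruct (Rle_dec a b)
  | |- context [Rlt_dec ?a ?b] => destruct (Rlt_dec a b) end; try lra.

(** In the right half plane [atan] inverts [tan]; in the left one it does so after a shift of the
    angle by [PI], a period of [tan]. The two vertical directions are treated separately. *)
Lemma atan2_polar r t : 0 < r -> - PI < t <= PI -> atan2 (r * sin t) (r * cos t) = t.
Proof.
  intros Hr Ht. pose proof PI_RGT_0.
  assert (Q : forall s, cos s <> 0 -> r * sin s / (r * cos s) = tan s)
    by (intros; unfold tan; field; lra).
  unfold atan2.
  destruct (Rtotal_order t (PI/2)) as [H1|[->|H1]].
  - destruct (Rtotal_order t (-(PI/2))) as [H2|[->|H2]].
    + assert (cos t < 0).
      { rewrite <- (cos_neg t). apply cos_lt_0; lra. }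
      assert (sin t < 0) by (apply sin_lt_0_var; lra).
      destruct (Rlt_dec 0 (r * cos t)); [nra|]. destruct (Rlt_dec (r * cos t) 0); [|nra].
      destruct (Rle_dec 0 (r * sin t)); [nra|]. rewrite Q by lra.
      replace (tan t) with (tan (t + PI)).
      * rewrite atan_tan; lra.
      * unfold tan. rewrite neg_sin, neg_cos. field. lra.
    + rewrite cos_neg, sin_neg, cos_PI2, sin_PI2.
      destruct (Rlt_dec 0 (r * 0)); [lra|]. destruct (Rlt_dec (r * 0) 0); [lra|].
      destruct (Rlt_dec 0 (r * - (1))); [lra|]. destruct (Rlt_dec (r * - (1)) 0); lra.
    + assert (0 < cos t) by (apply cos_gt_0; lra).
      destruct (Rlt_dec 0 (r * cos t)); [|nra]. rewrite Q by lra. apply atan_tan; lra.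
  - rewrite cos_PI2, sin_PI2.
    destruct (Rlt_dec 0 (r * 0)); [lra|]. destruct (Rlt_dec (r * 0) 0); [lra|].
    destruct (Rlt_dec 0 (r * 1)); lra.
  - assert (cos t < 0) by (apply cos_lt_0; lra).
    assert (0 <= sin t) by (apply sin_ge_0; lra).
    destruct (Rlt_dec 0 (r * cos t)); [nra|]. destruct (Rlt_dec (r * cos t) 0); [|nra].
    destruct (Rle_dec 0 (r * sin t)); [|nra]. rewrite Q by lra.
    replace (tan t) with (tan (t - PI)).
    * rewrite atan_tan; lra.
    * unfold tan, Rminus. rewrite sin_plus, cos_plus, sin_neg, cos_neg, sin_PI, cos_PI. field. lra.
Qed.

Lemma atan2_scale k y x : 0 < k -> atan2 (k * y) (k * x) = atan2 y x.
Proof.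
  intros Hk. unfold atan2.
  assert (Q : x <> 0 -> k * y / (k * x) = y / x) by (intros; field; lra).
  destruct (Rlt_dec 0 x), (Rlt_dec 0 (k * x)); try nra.
  { rewrite Q by lra. reflexivity. }
  destruct (Rlt_dec x 0), (Rlt_dec (k * x) 0); try nra.
  { rewrite Q by lra. destruct (Rle_dec 0 y), (Rle_dec 0 (k * y)); try nra; reflexivity. }
  destruct (Rlt_dec 0 y), (Rlt_dec 0 (k * y)); try nra.
  destruct (Rlt_dec y 0), (Rlt_dec (k * y) 0); nra.
Qed.

(** The angle is plus or minus [acos (x / r)], with the sign of the second coordinate. As that
    coordinate is nonzero, the direction of the branch cut is avoided and the bounds are strict. *)
Lemma polar_exists u : snd u <> 0 ->
  exists r t, 0 < r /\ - PI < t < PI /\ u = (r * cos t, r * sin t).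
Proof.
  destruct u as [x y]; simpl. intros Hy.
  set (r := sqrt (x * x + y * y)).
  assert (0 < y * y) by nra.
  assert (Hr : 0 < r) by (apply sqrt_lt_R0; nra).
  assert (Hrr : r * r = x * x + y * y) by (apply sqrt_sqrt; nra).
  assert (Hx : r * (x / r) = x) by (field; lra).
  set (c := x / r) in *.
  assert (Hc : 1 - c² = (y / r)²).
  { unfold Rsqr, c. field_simplify_eq; [|lra]. nra. }
  assert (Hc1 : -1 <= c <= 1).
  { assert (0 <= (y / r)²) by apply Rle_0_sqr. unfold Rsqr in *. split; nra. }
  assert (B := acos_bound c).
  assert (Hs : sin (acos c) = Rabs y / r).
  { rewrite sin_acos, Hc, sqrt_Rsqr_abs by auto. unfold Rdiv.
    rewrite Rabs_mult, (Rabs_right (/ r)); auto.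
    apply Rle_ge, Rlt_le, Rinv_0_lt_compat; auto. }
  assert (acos c <> PI).
  { intros E. rewrite E, sin_PI in Hs.
    assert (0 < Rabs y / r) by (apply Rdiv_lt_0_compat; auto; apply Rabs_pos_lt; auto). lra. }
  pose proof PI_RGT_0.
  destruct (Rlt_dec 0 y).
  - exists r, (acos c). repeat split; try lra.
    rewrite cos_acos, Hx, Hs, Rabs_right by lra. f_equal. field. lra.
  - exists r, (- acos c). repeat split; try lra.
    rewrite cos_neg, sin_neg, cos_acos, Hx, Hs, Rabs_left by lra. f_equal. field. lra.
Qed.

Lemma arg_polar u : snd u <> 0 ->
  exists r, 0 < r /\ - PI < arg u < PI /\ u = (r * cos (arg u), r * sin (arg u)).
Proof.
  intros H. destruct (polar_exists u H) as (r & t & Hr & Ht & E).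
  assert (arg u = t) as ->; [|eauto].
  unfold arg. rewrite E. simpl. apply atan2_polar; lra.
Qed.

Lemma arg_sign u : snd u <> 0 -> 0 < snd u /\ 0 < arg u < PI \/ snd u < 0 /\ - PI < arg u < 0.
Proof.
  intros H. destruct (arg_polar u H) as (r & Hr & Ht & E).
  assert (E' : snd u = r * sin (arg u)) by (rewrite E at 1; reflexivity).
  destruct (Rtotal_order (arg u) 0) as [K|[K|K]].
  - right. assert (sin (arg u) < 0) by (apply sin_lt_0_var; lra). split; nra.
  - rewrite K, sin_0 in E'. lra.
  - left. assert (0 < sin (arg u)) by (apply sin_gt_0; lra). split; nra.
Qed.

Lemma cross_dot_polar u w : snd u <> 0 -> snd w <> 0 ->
  exists r, 0 < r /\ cross u w = r * sin (arg w - arg u) /\ dot u w = r * cos (arg w - arg u).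
Proof.
  intros Hu Hw.
  destruct (arg_polar u Hu) as (r & Hr & _ & Eu), (arg_polar w Hw) as (s & Hs & _ & Ew).
  set (a := arg u) in *. set (b := arg w) in *. clearbody a b. subst u w.
  exists (r * s). split; [nra|].
  unfold cross, dot, Rminus; simpl. rewrite sin_plus, cos_plus, sin_neg, cos_neg. split; ring.
Qed.

(** The difference of two arguments is within one period of the interval where [atan2] takes its
    values. *)
Lemma signed_angle_arg u w : snd u <> 0 -> snd w <> 0 ->
  let t := arg w - arg u in
  signed_angle u w =
    if Rle_dec t (- PI) then t + 2 * PI else if Rlt_dec PI t then t - 2 * PI else t.
Proof.
  intros Hu Hw t. destruct (cross_dot_polar u w Hu Hw) as (r & Hr & Ec & Ed).
  unfold signed_angle. rewrite Ec, Ed. fold t.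
  destruct (arg_polar u Hu) as (_ & _ & ? & _), (arg_polar w Hw) as (_ & _ & ? & _).
  pose proof PI_RGT_0.
  destruct (Rle_dec t (- PI)); [|destruct (Rlt_dec PI t)]; unfold t in *.
  - rewrite <- (sin_period _ 1), <- (cos_period _ 1). simpl INR.
    rewrite atan2_polar by lra. lra.
  - assert (P : forall s, sin (s - 2 * PI) = sin s /\ cos (s - 2 * PI) = cos s).
    { intros s. rewrite <- (sin_period (s - 2 * PI) 1), <- (cos_period (s - 2 * PI) 1). simpl INR.
      split; f_equal; ring. }
    destruct (P (arg w - arg u)) as [<- <-].
    apply atan2_polar; lra.
  - apply atan2_polar; lra.
Qed.

Lemma ccw_angle_arg u w : snd u <> 0 -> snd w <> 0 ->
  ccw_angle u w = if Rlt_dec (arg w) (arg u) then arg w - arg u + 2 * PI else arg w - arg u.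
Proof.
  intros Hu Hw. unfold ccw_angle. rewrite signed_angle_arg by auto.
  destruct (arg_polar u Hu) as (_ & _ & ? & _), (arg_polar w Hw) as (_ & _ & ? & _).
  pose proof PI_RGT_0. cbv zeta.
  destruct (Rle_dec _ _); [|destruct (Rlt_dec PI _)]; destruct (Rlt_dec (arg w) (arg u));
  destruct (Rlt_dec _ 0); lra.
Qed.

Lemma sin_sign t : - PI < t < PI -> 0 < t /\ 0 < sin t \/ t = 0 /\ sin t = 0 \/ t < 0 /\ sin t < 0.
Proof.
  intros. destruct (Rtotal_order t 0) as [K|[K|K]].
  - right; right. split; auto. apply sin_lt_0_var; lra.
  - subst. right; left. auto using sin_0.
  - left. split; auto. apply sin_gt_0; lra.
Qed.

(** The argument grows from right to left above the horizontal and from left to right below it, and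
    every lower direction has a smaller argument than every upper one. The correction for a lower
    [u] therefore also yields false for directions on opposite sides. *)
Lemma dir_right_arg u w : snd u <> 0 -> snd w <> 0 -> arg u <> arg w ->
  dir_right u w = xorb (ltb (arg u) (arg w)) (ltb (snd u) 0).
Proof.
  intros Hu Hw N. destruct (cross_dot_polar u w Hu Hw) as (r & Hr & Ec & _).
  unfold dir_right. rewrite Ec.
  destruct (arg_sign u Hu) as [[Su Au]|[Su Au]], (arg_sign w Hw) as [[Sw Aw]|[Sw Aw]].
  2, 3: clear Ec; split_ltb; reflexivity.
  all: destruct (sin_sign (arg w - arg u)) as [[K S]|[[K S]|[K S]]]; try lra.
  all: assert (P := Rmult_lt_compat_l r _ _ Hr S); clear Ec; set (q := r * sin _) in *; clearbody q.
  all: split_ltb; reflexivity.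
Qed.

Lemma arg_ne_of_cross u w : snd u <> 0 -> snd w <> 0 ->
  (0 < snd u * snd w -> cross u w <> 0) -> arg u <> arg w.
Proof.
  intros Hu Hw H E. destruct (cross_dot_polar u w Hu Hw) as (r & Hr & Ec & _).
  rewrite E, Rminus_diag, sin_0, Rmult_0_r in Ec.
  destruct (arg_sign u Hu) as [[Su Au]|[Su Au]], (arg_sign w Hw) as [[Sw Aw]|[Sw Aw]]; try lra;
  apply H; auto; nra.
Qed.

(** The vector [vsub (0, 0) u] points back along the incoming step. The turn passes through (-1, 0)
    when this ray and [w] lie on one side of the horizontal with [w] further left; the sign is
    positive for a passage from the upper to the lower half plane. *)
Definition jump (u w : pt) : Z :=
  if dir_right (vsub (0, 0) u) w then (if Rlt_dec 0 (snd u) then 1%Z else (-1)%Z) else 0%Z.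

(* The argument jumps exactly when the turn passes through the direction (-1, 0). *)
Lemma signed_angle_jump u w : snd u <> 0 -> snd w <> 0 ->
  (snd u * snd w < 0 -> cross u w <> 0) ->
  signed_angle u w = arg w - arg u + 2 * PI * IZR (jump u w).
Proof.
  intros Hu Hw H. rewrite signed_angle_arg by auto. cbv zeta.
  destruct (cross_dot_polar u w Hu Hw) as (r & Hr & Ec & _).
  unfold jump, dir_right.
  replace (cross (vsub (0, 0) u) w) with (- cross u w) by (unfold cross, vsub; simpl; ring).
  unfold vsub; cbn [snd].
  pose proof PI_RGT_0.
  destruct (arg_sign u Hu) as [[Su Au]|[Su Au]], (arg_sign w Hw) as [[Sw Aw]|[Sw Aw]].
  1, 4: clear Ec H; case_dec;
        rewrite ?(ltb_false 0 (0 - snd u)), ?(ltb_false 0 (snd w)),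
         ?(ltb_false (snd w) 0), ?(ltb_false (0 - snd u) 0), ?andb_false_r by lra; simpl; case_dec.
  (* The shift by [PI] moves the difference of arguments into (-[PI], [PI]), where the sign of the
     sine, hence that of the cross product, decides on which side of -[PI] the difference lies. *)
  - assert (P : sin (arg w - arg u) = - sin (arg w - arg u + PI)) by (rewrite neg_sin; ring).
    assert (C : cross u w <> 0) by (apply H; nra). clear H.
    destruct (sin_sign (arg w - arg u + PI)) as [[K S]|[[K S]|[K S]]]; try lra.
    + assert (cross u w < 0) by (rewrite Ec, P; nra). clear Ec.
      split_ltb; simpl. case_dec.
    + rewrite Ec, P, S in C. lra.
    + assert (0 < cross u w) by (rewrite Ec, P; nra). clear Ec.
      split_ltb; simpl. destruct (Rlt_dec 0 (snd u)); [|lra].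
      case_dec.
  - assert (P : sin (arg w - arg u) = - sin (arg w - arg u - PI)).
    { rewrite <- neg_sin. f_equal; ring. }
    assert (C : cross u w <> 0) by (apply H; nra). clear H.
    destruct (sin_sign (arg w - arg u - PI)) as [[K S]|[[K S]|[K S]]]; try lra.
    + assert (cross u w < 0) by (rewrite Ec, P; nra). clear Ec.
      split_ltb; simpl. destruct (Rlt_dec 0 (snd u)); [lra|].
      case_dec.
    + rewrite Ec, P, S in C. lra.
    + assert (0 < cross u w) by (rewrite Ec, P; nra). clear Ec.
      split_ltb; simpl. case_dec.
Qed.

Lemma odd_jump u w : Z.odd (jump u w) = dir_right (vsub (0, 0) u) w.
Proof. unfold jump. destruct (dir_right _ _); [destruct (Rlt_dec _ _)|]; reflexivity. Qed.

Definition ray_arg (p x : pt) : R := arg (vsub x p).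

(** Cutting the circle at (-1, 0) turns the cyclic order into the linear order of arguments; the
    three disjuncts are the three places where the cut can fall among the rays. *)
Lemma ccw_between_arg pos v x y z :
  snd (pos x) <> snd (pos v) -> snd (pos y) <> snd (pos v) -> snd (pos z) <> snd (pos v) ->
  let a := ray_arg (pos v) in
  a (pos x) <> a (pos y) -> a (pos x) <> a (pos z) -> a (pos y) <> a (pos z) ->
  ccw_between pos v x y z =
    ltb (a (pos x)) (a (pos y)) && ltb (a (pos y)) (a (pos z)) ||
    ltb (a (pos y)) (a (pos z)) && ltb (a (pos z)) (a (pos x)) ||
    ltb (a (pos z)) (a (pos x)) && ltb (a (pos x)) (a (pos y)).
Proof.
  intros Hx Hy Hz a Nxy Nxz Nyz.
  assert (S : forall p, snd (pos p) <> snd (pos v) -> snd (vsub (pos p) (pos v)) <> 0)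
    by (intros p Hp; simpl; lra).
  assert (B : forall p, snd (pos p) <> snd (pos v) -> - PI < a (pos p) < PI).
  { intros p Hp. destruct (arg_polar _ (S p Hp)) as (r & _ & Bp & _). exact Bp. }
  assert (Bx := B x Hx). assert (By := B y Hy). assert (Bz := B z Hz).
  unfold ccw_between. rewrite !ccw_angle_arg by auto.
  change (arg (vsub (pos x) (pos v))) with (a (pos x)).
  change (arg (vsub (pos y) (pos v))) with (a (pos y)).
  change (arg (vsub (pos z) (pos v))) with (a (pos z)).
  generalize dependent (a (pos x)). generalize dependent (a (pos y)).
  generalize dependent (a (pos z)). clear. intros z Bz y Nyz By x Nxy Nxz Bx.
  destruct (Rlt_dec y x), (Rlt_dec z x), (Rlt_dec y z); try lra;
  repeat match goal with |- context [ltb ?p ?q] =>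
    first [rewrite (ltb_true p q) by lra | rewrite (ltb_false p q) by lra] end;
  case_dec; reflexivity.
Qed.

(** Two pairs of points on a line interlace exactly when the number of comparisons [x < y], with [x]
    in the first pair and [y] in the second, is odd. In passing from arguments to [dir_right], the
    corrections for lower rays occur twice for each of [a] and [b] and cancel. *)
Lemma trans_cross_rays pos v a b c d :
  let h x := snd (pos x) <> snd (pos v) in
  let ne x y := ray_arg (pos v) (pos x) <> ray_arg (pos v) (pos y) in
  h a -> h b -> h c -> h d -> ne a b -> ne a c -> ne a d -> ne b c -> ne b d -> ne c d ->
  trans_cross pos (v, (a, b)) (v, (c, d)) =
    let r x y := ray_right (pos v) (pos x) (pos v) (pos y) in
    xorb (xorb (r a c) (r a d)) (xorb (r b c) (r b d)).
Proof.
  intros h ne Ha Hb Hc Hd Nab Nac Nad Nbc Nbd Ncd. unfold h, ne in *. clear h ne.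
  unfold trans_cross, cyc4. rewrite Nat.eqb_refl.
  rewrite !ccw_between_arg by auto.
  cbv zeta. unfold ray_right. rewrite eqh_refl.
  rewrite !dir_right_arg by (simpl; auto; lra).
  change (fun x => arg (vsub x (pos v))) with (ray_arg (pos v)).
  fold (ray_arg (pos v) (pos a)) (ray_arg (pos v) (pos b))
       (ray_arg (pos v) (pos c)) (ray_arg (pos v) (pos d)).
  generalize (ltb (snd (vsub (pos a) (pos v))) 0) (ltb (snd (vsub (pos b) (pos v))) 0).
  generalize dependent (ray_arg (pos v) (pos a)). generalize dependent (ray_arg (pos v) (pos b)).
  generalize dependent (ray_arg (pos v) (pos c)). generalize dependent (ray_arg (pos v) (pos d)).
  clear. intros d c Ncd b Nbc Nbd a Nab Nac Nad s t.
  destruct (Rdichotomy _ _ Nab), (Rdichotomy _ _ Nac), (Rdichotomy _ _ Nad),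
    (Rdichotomy _ _ Nbc), (Rdichotomy _ _ Nbd), (Rdichotomy _ _ Ncd); try lra;
  repeat match goal with |- context [ltb ?p ?q] =>
    first [rewrite (ltb_true p q) by assumption | rewrite (ltb_false p q) by (left; assumption)] end;
  destruct s, t; reflexivity.
Qed.

(** * Closed walks *)

Definition side_of (w y p : pt) : bool :=
  if ltb (snd w) (snd y) then ltb (snd w) (snd p) else ltb (snd p) (snd w).

Lemma side_of_self w y : snd y <> snd w -> side_of w y y = true.
Proof.
  intros H. unfold side_of. destruct (Rdichotomy _ _ H).
  - rewrite ltb_false by lra. apply ltb_true. lra.
  - rewrite !ltb_true by lra. reflexivity.
Qed.

(** Two rays from one vertex on the same side of the horizontal are not parallel, so exactly one is
    to the right of the other; rays on opposite sides are never counted. *)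
Lemma ray_right_swap v x w y :
  snd x <> snd v -> snd y <> snd w -> (snd v = snd w -> v = w) ->
  (v = w -> meet_at_ends v x v y) ->
  xorb (ray_right v x w y) (ray_right w y v x) = eqh v w && side_of w y x.
Proof.
  intros Hx Hy E M. unfold ray_right, eqh.
  destruct (Req_EM_T (snd v) (snd w)) as [K|K], (Req_EM_T (snd w) (snd v)); try lra; [|reflexivity].
  specialize (E K). subst w. specialize (M eq_refl). cbn [andb].
  unfold dir_right, side_of.
  replace (cross (vsub y v) (vsub x v)) with (- cross (vsub x v) (vsub y v))
    by (unfold cross; ring).
  assert (N := cross_nonzero v x y M Hx).
  set (c := cross _ _) in *. clearbody c. clear M.
  cbn [snd vsub].
  destruct (Rdichotomy _ _ Hx), (Rdichotomy _ _ Hy).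
  2, 3: clear N; split_ltb; reflexivity.
  all: assert (c <> 0) by (apply N; nra); clear N; finish.
Qed.

(** A closed walk is an infinite sequence of period [k], so that shifted indices need no reduction
    modulo [k]. *)
Definition closed_walk (k : nat) (P : nat -> pt) : Prop :=
  (0 < k)%nat /\ (forall i, P (i + k)%nat = P i) /\ forall i, snd (P i) <> snd (P (S i)).

Definition separated (P Q : nat -> pt) : Prop := forall i j, snd (P i) = snd (Q j) -> P i = Q j.

Definition edge_simple (k : nat) (P : nat -> pt) : Prop :=
  forall i j, (i mod k <> j mod k)%nat -> meet_at_ends (P i) (P (S i)) (P j) (P (S j)).

(* The passage of index [i] is the one through [P (S i)], entered from [P i] and left towards
   [P (S (S i))]; the letters o and i stand for the outgoing and the incoming ray. *)
Definition ray_oo (P Q : nat -> pt) i j := ray_right (P (S i)) (P (S (S i))) (Q (S j)) (Q (S (S j))).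
Definition ray_oi (P Q : nat -> pt) i j := ray_right (P (S i)) (P (S (S i))) (Q (S j)) (Q j).
Definition ray_io (P Q : nat -> pt) i j := ray_right (P (S i)) (P i) (Q (S j)) (Q (S (S j))).
Definition ray_ii (P Q : nat -> pt) i j := ray_right (P (S i)) (P i) (Q (S j)) (Q j).

Definition passage_cross (P Q : nat -> pt) i j : bool :=
  xorb (xorb (ray_ii P Q i j) (ray_io P Q i j)) (xorb (ray_oi P Q i j) (ray_oo P Q i j)).

(** Edges are indexed by the passage they leave: edge [j] runs from [Q (S j)] to [Q (S (S j))]. *)
Definition vertex_right (P Q : nat -> pt) i j := right_of (P (S i)) (Q (S j)) (Q (S (S j))).
Definition vertex_between (P Q : nat -> pt) i j := height_between (P (S i)) (Q (S j)) (Q (S (S j))).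

(** An edge is the outgoing ray of its own passage and the incoming ray of the next one, whence the
    shifted indices. *)
Lemma walk_pair_events P Q i j :
  pair_events (P (S i)) (P (S (S i))) (Q (S j)) (Q (S (S j))) =
  xorb (xorb (xorb (vertex_right P Q i j) (vertex_right P Q (S i) j))
             (xorb (vertex_right Q P j i) (vertex_right Q P (S j) i)))
  (xorb (xorb (vertex_between Q P j i) (vertex_between Q P (S j) i))
        (xorb (xorb (ray_oo P Q i j) (ray_oi P Q i (S j)))
              (xorb (ray_io P Q (S i) j) (ray_ii P Q (S i) (S j))))).
Proof. reflexivity. Qed.

Lemma walk_period k P : closed_walk k P -> P k = P 0%nat /\ P (S k) = P 1%nat /\ P (S (S k)) = P 2%nat.
Proof. intros (_ & H & _). repeat split; [apply (H 0%nat) | apply (H 1%nat) | apply (H 2%nat)]. Qed.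

Lemma walk_mod k P i : closed_walk k P -> P (i mod k)%nat = P i.
Proof.
  intros (Hk & H & _).
  rewrite (Nat.div_mod i k) at 2 by lia. generalize (i mod k)%nat (i / k)%nat. intros r q.
  induction q as [|q IH].
  - f_equal. lia.
  - rewrite IH, <- (H (k * q + r)%nat). f_equal. lia.
Qed.

Lemma walk_mod_eq k P i j : closed_walk k P -> (i mod k = j mod k)%nat -> P i = P j.
Proof. intros H E. rewrite <- (walk_mod k P i), <- (walk_mod k P j), E; auto. Qed.

Lemma pair_events_even_walk k l P Q i j :
  closed_walk k P -> closed_walk l Q -> separated P Q ->
  meet_at_ends (P i) (P (S i)) (Q j) (Q (S j)) ->
  pair_events (P i) (P (S i)) (Q j) (Q (S j)) = false.
Proof.
  intros (_ & _ & HP) (_ & _ & HQ) S M. apply pair_events_even; auto.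
Qed.

Lemma xsum2_xorb k l F G :
  xsum k (fun i => xsum l (fun j => xorb (F i j) (G i j))) =
  xorb (xsum k (fun i => xsum l (F i))) (xsum k (fun i => xsum l (G i))).
Proof. rewrite <- xsum_xorb. apply xsum_ext. intros. apply xsum_xorb. Qed.

(** The sum of [pair_events] over all pairs of edges is zero. Being taken over two full cycles, it
    can be shifted freely in each index, so the ray terms assemble into [passage_cross] without
    boundary terms. *)
Lemma mutual_crossings_even k l P Q :
  closed_walk k P -> closed_walk l Q -> separated P Q ->
  (forall i j, meet_at_ends (P i) (P (S i)) (Q j) (Q (S j))) ->
  xsum k (fun i => xsum l (passage_cross P Q i)) = false.
Proof.
  intros HP HQ Hs M.
  destruct (walk_period k P HP) as (P0 & P1 & P2).
  destruct (walk_period l Q HQ) as (Q0 & Q1 & Q2).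
  assert (Z : xsum k (fun i => xsum l (fun j =>
             pair_events (P (S i)) (P (S (S i))) (Q (S j)) (Q (S (S j))))) = false).
  { apply xsum_false. intros i _. apply xsum_false. intros j _.
    eapply pair_events_even_walk; eauto. }
  (* For [CQ] and [CP]: a vertex is an end of two consecutive edges, so its comparison with a fixed
     edge of the other walk occurs twice. *)
  assert (CQ : forall F : nat -> nat -> bool, (forall i, F l i = F 0%nat i) ->
     xsum k (fun i => xsum l (fun j => xorb (F j i) (F (S j) i))) = false).
  { intros F HF. apply xsum_false. intros i _. apply (xsum_cyclic l (fun j => F j i)). auto. }
  assert (CP : xsum k (fun i => xsum l (fun j =>
     xorb (vertex_right P Q i j) (vertex_right P Q (S i) j))) = false).
  { rewrite xsum_exchange. apply xsum_false. intros j _.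
    apply (xsum_cyclic k (fun i => vertex_right P Q i j)). unfold vertex_right. rewrite P1. reflexivity. }
  assert (SP : forall F : nat -> nat -> bool, (forall j, F k j = F 0%nat j) ->
    xsum k (fun i => xsum l (fun j => F (S i) j)) = xsum k (fun i => xsum l (F i))).
  { intros F HF. transitivity (xsum l (fun j => xsum k (fun i => F (S i) j))); [apply xsum_exchange|].
    transitivity (xsum l (fun j => xsum k (fun i => F i j))); [|symmetry; apply xsum_exchange].
    apply xsum_ext. intros j _.
    apply (xsum_shift k (fun i => F i j)). auto. }
  assert (SQ : forall F : nat -> nat -> bool, (forall i, F i l = F i 0%nat) ->
    xsum k (fun i => xsum l (fun j => F i (S j))) = xsum k (fun i => xsum l (F i))).
  { intros F HF. apply xsum_ext. intros i _. apply (xsum_shift l (F i)). auto. }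
  rewrite (xsum_ext k _ (fun i => xsum l (fun j => _))) in Z
    by (intros; apply xsum_ext; intros; apply walk_pair_events).
  rewrite !xsum2_xorb in Z.
  rewrite <- (xsum2_xorb k l (fun i j => vertex_right P Q i j)) in Z.
  rewrite CP in Z.
  rewrite <- (xsum2_xorb k l (fun i j => vertex_right Q P j i)) in Z.
  rewrite (CQ (vertex_right Q P)) in Z by (intros; unfold vertex_right; rewrite Q1; auto).
  rewrite <- (xsum2_xorb k l (fun i j => vertex_between Q P j i)) in Z.
  rewrite (CQ (vertex_between Q P)) in Z by (intros; unfold vertex_between; rewrite Q1; auto).
  rewrite (SQ (ray_oi P Q)) in Z by (intros; unfold ray_oi; rewrite Q0, Q1; auto).
  rewrite (SP (ray_io P Q)) in Z by (intros; unfold ray_io; rewrite P0, P1; auto).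
  rewrite (SP (fun i j => ray_ii P Q i (S j))) in Z by (intros; unfold ray_ii; rewrite P0, P1; auto).
  rewrite (SQ (ray_ii P Q)) in Z by (intros; unfold ray_ii; rewrite Q0, Q1; auto).
  unfold passage_cross. rewrite !xsum2_xorb.
  rewrite <- Z. btauto.
Qed.

(** Consecutive edges have different indices modulo [k], for otherwise the step between their
    starting points would be horizontal. *)
Lemma edge_simple_turn k P i :
  closed_walk k P -> edge_simple k P -> meet_at_ends (P (S i)) (P i) (P (S i)) (P (S (S i))).
Proof.
  intros H He. apply meet_at_ends_flip_l, He. intros E.
  apply (walk_mod_eq k P) in E; auto. destruct H as (_ & _ & H). apply (H i). congruence.
Qed.

Lemma edge_simple_in_out k P i j :
  closed_walk k P -> edge_simple k P -> P (S i) = P (S j) ->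
  meet_at_ends (P (S i)) (P i) (P (S i)) (P (S (S j))).
Proof.
  intros H He E. assert (M : meet_at_ends (P i) (P (S i)) (P (S j)) (P (S (S j)))).
  2:{ rewrite <- E in M. apply meet_at_ends_flip_l, M. }
  apply He. intros F.
  apply (walk_mod_eq k P) in F; auto. destruct H as (_ & _ & H). apply (H i). congruence.
Qed.

Lemma ray_right_loop k P i j :
  closed_walk k P -> separated P P -> edge_simple k P ->
  xorb (ray_oi P P i j) (ray_io P P j i) =
  eqh (P (S i)) (P (S j)) && side_of (P (S j)) (P j) (P (S (S i))).
Proof.
  intros H Hs He. assert (Hh := proj2 (proj2 H)). apply ray_right_swap; auto.
  intros E. apply meet_at_ends_sym. rewrite E. apply (edge_simple_in_out k); auto.
Qed.

(** The sum of [pair_events] over [i < j] is zero, but aligning the ray terms of a triangle leaves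
    boundary terms. All of these concern the vertex [P 1] and add up to [true]; the diagonal terms
    are the turns at single passages, where consecutive edges meet. *)
Lemma self_crossings k P :
  closed_walk k P -> separated P P -> edge_simple k P ->
  xorb (xtri k (passage_cross P P)) (xsum k (fun q => ray_io P P q q)) = true.
Proof.
  intros H Hs He.
  destruct (walk_period k P H) as (P0 & P1 & P2).
  assert (Hh := proj2 (proj2 H)).
  assert (Z : xtri k (fun i j =>
             pair_events (P (S i)) (P (S (S i))) (P (S j)) (P (S (S j)))) = false).
  { apply xsum_false. intros j Hj. apply xsum_false. intros i Hi.
    apply (pair_events_even_walk k k P P (S i) (S j)); auto.
    apply He. intros E.
    destruct (Nat.eq_dec (S j) k) as [F|].
    - rewrite F, Nat.Div0.mod_same, Nat.mod_small in E by lia. lia.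
    - rewrite !Nat.mod_small in E by lia. lia. }
  rewrite (xtri_ext k _ _ (fun i j _ => walk_pair_events P P i j)) in Z.
  (* These terms are symmetric in the two edges and vanish on the diagonal, so the triangle equals a
     square sum, which cancels around the cycle. *)
  assert (T : xtri k (fun i j =>
      xorb (xorb (vertex_right P P i j) (vertex_right P P (S i) j))
           (xorb (vertex_right P P j i) (vertex_right P P (S j) i))) = false).
  { pose (F := fun i j => xorb (vertex_right P P i j) (vertex_right P P (S i) j)).
    assert (D : forall i, F i i = false).
    { intros i. unfold F, vertex_right, right_of.
      rewrite !(ltb_false (snd (P (S i))) (snd (P (S i)))) by lra.
      rewrite !(ltb_false (snd (P (S (S i)))) (snd (P (S (S i))))) by lra.
      btauto. }
    pose proof (xsum_square k F) as Q.
    rewrite (xsum_false k (fun i => F i i)), xorb_false_r in Q by auto.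
    change (xtri k (fun i j => xorb (F i j) (F j i)) = false). rewrite <- Q.
    rewrite xsum_exchange. apply xsum_false. intros j _.
    apply (xsum_cyclic k (fun i => vertex_right P P i j)). unfold vertex_right. rewrite P1. reflexivity. }
  (* These terms are not symmetric. They telescope over [j] and leave the comparisons of [P (S k)],
     which is [P 1], with all edges. *)
  assert (B : xtri k (fun i j => xorb (vertex_between P P j i) (vertex_between P P (S j) i))
     = xsum k (vertex_between P P 0)).
  { pose (f := fun j => xsum j (vertex_between P P j)).
    transitivity (xsum k (fun j => xorb (f j) (f (S j)))).
    - apply xsum_ext. intros j _. rewrite xsum_xorb. unfold f. cbn [xsum].
      replace (vertex_between P P (S j) j) with false; [rewrite xorb_false_r; reflexivity|].
      unfold vertex_between, height_between.
      rewrite !(ltb_false (snd (P (S (S j)))) (snd (P (S (S j))))) by lra.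
      btauto.
    - rewrite xsum_telescope. unfold f. cbn [xsum]. rewrite xorb_false_l.
      apply xsum_ext. intros i _. unfold vertex_between. rewrite P1. reflexivity. }
  rewrite (xtri_xorb k (fun i j => xorb (xorb _ _) (xorb _ _))) in Z. rewrite T, xorb_false_l in Z.
  rewrite (xtri_xorb k (fun i j => xorb (vertex_between P P j i) _)), B in Z.
  rewrite !xtri_xorb in Z.
  rewrite (xtri_shift_right k (ray_oi P P)) in Z.
  2:{ intros j. unfold ray_oi, ray_right. rewrite eqh_false; auto. }
  rewrite (xtri_shift_left k (ray_io P P)) in Z.
  rewrite (xtri_shift_both k (ray_ii P P)) in Z by (intros; unfold ray_ii; rewrite P0, P1; auto).
  pose (g := side_of (P 1%nat) (P 0%nat)).
  (* The boundary terms of the two mixed shifts compare the incoming ray of passage 0 with every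
     outgoing ray at [P 1] in both orders; a pair counts when both rays are on one side. *)
  assert (NO : xorb (xsum k (fun i => ray_oi P P i k)) (xsum k (fun j => ray_io P P 0 j)) =
     xsum k (fun q => eqh (P (S q)) (P 1%nat) && g (P (S (S q))))).
  { rewrite <- xsum_xorb. apply xsum_ext. intros q _.
    replace (ray_oi P P q k) with (ray_oi P P q 0) by (unfold ray_oi; rewrite P0, P1; auto).
    apply (ray_right_loop k); auto. }
  pose (sI := fun q => eqh (P (S q)) (P 1%nat) && g (P q)).
  (* The incoming ray of passage 0 contributes nothing against itself although [sI 0] is true; this
     missing term is the correction. *)
  assert (NI : xsum k (fun i => xorb (ray_ii P P i 0) (ray_ii P P 0 i)) = negb (xsum k sI)).
  { destruct k as [|k']; [destruct H; lia|]. rewrite !xsum_head.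
    rewrite xorb_nilpotent, xorb_false_l. unfold sI at 1, g at 1.
    rewrite eqh_refl, side_of_self by auto.
    cbn [andb]. transitivity (xsum k' (fun i => sI (S i))); [|destruct (xsum k' (fun i => sI (S i))); reflexivity].
    apply xsum_ext. intros i Hi.
    apply ray_right_swap; auto.
    intros E. rewrite E at 2. apply meet_at_ends_flip_l, meet_at_ends_flip_r, He.
    rewrite Nat.Div0.mod_0_l, Nat.mod_small; lia. }
  (* The closed walk enters and leaves the side [g] of the horizontal through [P 1] an even number
     of times in total. Each such change is an edge crossing that height, or an edge with one end at
     that height and the other on the side [g]. *)
  assert (L : xorb (xsum k (vertex_between P P 0)) (xorb
     (xsum k (fun q => eqh (P (S q)) (P 1%nat) && g (P (S (S q)))))
     (xsum k sI)) = false).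
  { rewrite <- (xsum_shift k sI) by (unfold sI; rewrite P0, P1; auto).
    rewrite <- !xsum_xorb.
    rewrite <- (xsum_cyclic k (fun i : nat => g (P (S i)))) by (rewrite P1; auto).
    apply xsum_ext. intros q _. unfold sI, vertex_between, height_between, g, side_of.
    set (a := P (S q)). set (b := P (S (S q))).
    assert (Hab : snd a <> snd b) by apply Hh. clearbody a b.
    assert (H01 := Hh 0%nat). revert H01. generalize (P 0%nat) (P 1%nat). clear - Hab.
    intros p v Hpv. unfold eqh.
    destruct (Req_EM_T (snd a) (snd v)), (Req_EM_T (snd b) (snd v)); try lra;
    destruct (Rdichotomy _ _ Hpv);
    repeat match goal with |- context [ltb ?x ?y] =>
     first [ rewrite (ltb_true x y) by lra | rewrite (ltb_false x y) by lra
      | destruct (Rtotal_order x y) as [?|[?|?]]; try lra ] end; reflexivity. }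
  unfold passage_cross. rewrite !xtri_xorb.
  rewrite NI in Z.
  set (d := xsum k (fun q => ray_io P P q q)) in *.
  clear - Z NO L.
  revert Z NO L.
  generalize (xtri k (ray_oo P P)) (xtri k (ray_ii P P)) (xtri k (ray_oi P P)) (xtri k (ray_io P P)).
  generalize (xsum k (vertex_between P P 0)) d (xsum k sI).
  generalize (xsum k (fun i => ray_oi P P i k)) (xsum k (fun j => ray_io P P 0 j)).
  generalize (xsum k (fun q => eqh (P (S q)) (P 1%nat) && g (P (S (S q))))).
  intros b1 b2 b3 b4 b5 b6 b7 b8 b9 b10.
  destruct b1, b2, b3, b4, b5, b6; simpl; try discriminate;
  destruct b7, b8, b9, b10; simpl; congruence.
Qed.

(** * Loops in an embedded graph *)

Lemma ray_arg_ne v x y :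
  snd x <> snd v -> snd y <> snd v -> meet_at_ends v x v y -> ray_arg v x <> ray_arg v y.
Proof.
  intros Hx Hy M. apply arg_ne_of_cross; try (simpl; lra).
  intros Hs. apply cross_nonzero; auto.
Qed.

Lemma nodup_map_seq {A} (f : nat -> A) k i j :
  NoDup (map f (seq 0 k)) -> (i < k)%nat -> (j < k)%nat -> f i = f j -> i = j.
Proof.
  intros H Hi Hj E.
  assert (Hn : forall m, (m < k)%nat -> nth m (map f (seq 0 k)) (f 0%nat) = f m)
    by (intros m Hm; rewrite map_nth, seq_nth; auto).
  rewrite (NoDup_nth _ (f 0%nat)) in H. apply H; rewrite ?length_map, ?length_seq; auto.
  rewrite !Hn; auto.
Qed.

Lemma cnth_mod g i : cnth g (i mod length g) = cnth g i.
Proof. unfold cnth. rewrite Nat.Div0.mod_mod. reflexivity. Qed.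

Lemma cnth_S_mod g i : cnth g (S (i mod length g)) = cnth g (S i).
Proof.
  rewrite <- (cnth_mod g (S (i mod length g))), <- (cnth_mod g (S i)). f_equal.
  rewrite <- (Nat.add_1_r (i mod _)), <- (Nat.add_1_r i). apply Nat.Div0.add_mod_idemp_l.
Qed.

Lemma cnth_period g i : cnth g (i + length g) = cnth g i.
Proof.
  rewrite <- (cnth_mod g (i + length g)), <- (cnth_mod g i). f_equal.
  rewrite <- (Nat.mul_1_l (length g)) at 1. apply Nat.Div0.mod_add.
Qed.

Lemma succ_mod_ne k i j : (i < j < k)%nat -> (S i mod k <> S j mod k)%nat.
Proof.
  intros H E. destruct (Nat.eq_dec (S j) k) as [F|].
  - rewrite F, Nat.Div0.mod_same, Nat.mod_small in E by lia. lia.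
  - rewrite !Nat.mod_small in E by lia. lia.
Qed.

Definition heights_distinct (n : nat) (pos : nat -> pt) : Prop :=
  forall v w, (v < n)%nat -> (w < n)%nat -> snd (pos v) = snd (pos w) -> v = w.

Definition walk_points (pos : nat -> pt) (g : list nat) (i : nat) : pt := pos (cnth g i).

Lemma loop_length_pos E g : is_loop E g -> (0 < length g)%nat.
Proof. intros (H & _). destruct g; [tauto|simpl; lia]. Qed.

Lemma loop_edge E g i : is_loop E g -> E (cnth g i) (cnth g (S i)).
Proof.
  intros H. assert (L := loop_length_pos E g H). destruct H as (_ & H & _).
  rewrite <- cnth_mod, <- cnth_S_mod. apply H. apply Nat.mod_upper_bound. lia.
Qed.

Lemma loop_edge_in g i : g <> [] -> In (ekey (cnth g i) (cnth g (S i))) (loop_edges g).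
Proof.
  intros H. rewrite <- cnth_mod, <- cnth_S_mod. unfold loop_edges.
  apply (in_map (fun i => ekey (cnth g i) (cnth g (S i)))), in_seq.
  assert (length g <> 0%nat) by (destruct g; simpl; [tauto|lia]).
  pose proof (Nat.mod_upper_bound i (length g)). lia.
Qed.

Lemma embedded_meet n pos E a b c d :
  straight_line_embedded n pos E -> E a b -> E c d -> ekey a b <> ekey c d ->
  meet_at_ends (pos a) (pos b) (pos c) (pos d).
Proof.
  intros (HE & _ & _ & Hi & _ & Hm) Hab Hcd N.
  destruct (HE _ _ Hab), (HE _ _ Hcd).
  assert (K : ~ ((a = c /\ b = d) \/ (a = d /\ b = c))).
  { intros [[-> ->]|[-> ->]]; apply N; auto. unfold ekey. f_equal; lia. }
  split; [eauto|].
  split; intros [K1 K2]; apply Hi in K1, K2; auto; tauto.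
Qed.

Lemma loop_closed_walk n pos E g :
  straight_line_embedded n pos E -> heights_distinct n pos -> is_loop E g ->
  closed_walk (length g) (walk_points pos g).
Proof.
  intros (HE & _ & Hirr & _) Hd H. unfold walk_points. split; [|split].
  - eapply loop_length_pos; eauto.
  - intros i. rewrite cnth_period. reflexivity.
  - intros i F. assert (K := loop_edge E g i H). destruct (HE _ _ K).
    apply Hd in F; auto. rewrite F in K. apply (Hirr _ K).
Qed.

Lemma loops_height_eq n pos E g h i j :
  straight_line_embedded n pos E -> heights_distinct n pos -> is_loop E g -> is_loop E h ->
  snd (walk_points pos g i) = snd (walk_points pos h j) -> cnth g i = cnth h j.
Proof.
  intros (HE & _) Hd Hg Hh F.
  destruct (HE _ _ (loop_edge E g i Hg)), (HE _ _ (loop_edge E h j Hh)). auto.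
Qed.

Lemma loops_separated n pos E g h :
  straight_line_embedded n pos E -> heights_distinct n pos -> is_loop E g -> is_loop E h ->
  separated (walk_points pos g) (walk_points pos h).
Proof.
  intros HE Hd Hg Hh i j F. unfold walk_points.
  f_equal. eapply loops_height_eq; eauto.
Qed.

Lemma loop_edge_simple n pos E g :
  straight_line_embedded n pos E -> is_loop E g ->
  edge_simple (length g) (walk_points pos g).
Proof.
  intros HE Hg i j N.
  apply (embedded_meet n pos E); try apply (loop_edge E); auto.
  intros F. apply N. assert (L := loop_length_pos E g Hg). destruct Hg as (_ & _ & Hn).
  apply (nodup_map_seq _ _ _ _ Hn); try (apply Nat.mod_upper_bound; lia).
  rewrite !cnth_mod, !cnth_S_mod. exact F.
Qed.

(** At a common vertex this is [trans_cross_rays]; at different vertices both sides are false, since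
    heights differ. The condition on the edges is imposed only at a common vertex, so that it also
    holds for consecutive passages of one loop, which share an edge. *)
Lemma trans_cross_passage n pos E g h i j :
  straight_line_embedded n pos E -> heights_distinct n pos -> is_loop E g -> is_loop E h ->
  let P := walk_points pos g in
  let Q := walk_points pos h in
  (P (S i) = Q (S j) ->
    meet_at_ends (P (S i)) (P i) (Q (S j)) (Q j) /\
    meet_at_ends (P (S i)) (P i) (Q (S j)) (Q (S (S j))) /\
    meet_at_ends (P (S i)) (P (S (S i))) (Q (S j)) (Q j) /\
    meet_at_ends (P (S i)) (P (S (S i))) (Q (S j)) (Q (S (S j)))) ->
  trans_cross pos (cnth g (S i), (cnth g i, cnth g (S (S i))))
                  (cnth h (S j), (cnth h j, cnth h (S (S j)))) = passage_cross P Q i j.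
Proof.
  intros HE Hd Hg Hh P Q M.
  assert (WP := loop_closed_walk n pos E g HE Hd Hg). fold P in WP.
  assert (WQ := loop_closed_walk n pos E h HE Hd Hh). fold Q in WQ.
  assert (TP := edge_simple_turn _ P i WP (loop_edge_simple n pos E g HE Hg)).
  assert (TQ := edge_simple_turn _ Q j WQ (loop_edge_simple n pos E h HE Hh)).
  destruct WP as (_ & _ & WP), WQ as (_ & _ & WQ).
  destruct (Nat.eq_dec (cnth g (S i)) (cnth h (S j))) as [F|F].
  - assert (F' : P (S i) = Q (S j)) by (unfold P, Q, walk_points; f_equal; exact F).
    destruct (M F') as (M1 & M2 & M3 & M4). clear M.
    assert (H1 := WP i). assert (H2 := WP (S i)). assert (H3 := WQ j). assert (H4 := WQ (S j)).
    unfold passage_cross, ray_ii, ray_io, ray_oi, ray_oo. rewrite F' in *.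
    rewrite F. unfold P, Q, walk_points in *.
    apply trans_cross_rays; auto; apply ray_arg_ne; auto.
  - unfold trans_cross. rewrite (proj2 (Nat.eqb_neq _ _) F).
    unfold passage_cross, ray_ii, ray_io, ray_oi, ray_oo, ray_right.
    rewrite eqh_false; [reflexivity|].
    intros K. apply F. eapply loops_height_eq; eauto.
Qed.

Lemma odd_mi n pos E g h :
  straight_line_embedded n pos E -> heights_distinct n pos -> is_loop E g -> is_loop E h ->
  (forall e, In e (loop_edges g) -> ~ In e (loop_edges h)) ->
  Nat.odd (mi pos g h) = false.
Proof.
  intros HE Hd Hg Hh N.
  assert (M : forall i j, meet_at_ends (walk_points pos g i) (walk_points pos g (S i))
                                       (walk_points pos h j) (walk_points pos h (S j))).
  { intros i j. apply (embedded_meet n pos E); try apply (loop_edge E); auto.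
    intros F. apply (N (ekey (cnth g i) (cnth g (S i)))).
    - apply loop_edge_in, Hg.
    - rewrite F. apply loop_edge_in, Hh. }
  unfold mi, transitions. rewrite odd_length_filter, xlist_prod, xlist_map, xlist_seq.
  rewrite <- (mutual_crossings_even (length g) (length h) (walk_points pos g) (walk_points pos h));
    eauto using loop_closed_walk, loops_separated.
  apply xsum_ext. intros i _. rewrite xlist_map, xlist_seq. apply xsum_ext. intros j _.
  cbn [fst snd]. eapply trans_cross_passage; eauto.
  intros _. auto 10 using meet_at_ends_flip_l, meet_at_ends_flip_r.
Qed.

Lemma length_transitions g : length (transitions g) = length g.
Proof. unfold transitions. rewrite length_map, length_seq. reflexivity. Qed.

Lemma nth_transitions g i d : (i < length g)%nat ->
  nth i (transitions g) d = (cnth g (S i), (cnth g i, cnth g (S (S i)))).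
Proof.
  intros Hi. unfold transitions.
  rewrite (nth_indep _ d ((fun i => (cnth g (S i), (cnth g i, cnth g (S (S i))))) 0%nat))
    by (rewrite length_map, length_seq; auto).
  rewrite (map_nth (fun i => (cnth g (S i), (cnth g i, cnth g (S (S i)))))).
  rewrite seq_nth by auto. reflexivity.
Qed.

Lemma odd_si n pos E g :
  straight_line_embedded n pos E -> heights_distinct n pos -> is_loop E g ->
  Nat.odd (si pos g) =
  xtri (length g) (passage_cross (walk_points pos g) (walk_points pos g)).
Proof.
  intros HE Hd Hg.
  assert (W := loop_closed_walk n pos E g HE Hd Hg).
  assert (He := loop_edge_simple n pos E g HE Hg).
  unfold si. cbv zeta. rewrite odd_length_filter, xlist_prod, xlist_seq, length_transitions.
  rewrite <- xsum_lt_xtri. apply xsum_ext. intros i Hi. rewrite xlist_seq.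
  apply xsum_ext. intros j Hj. cbn [fst snd].
  destruct (Nat.ltb_spec i j) as [L|L]; [|reflexivity]. cbn [andb].
  rewrite !nth_transitions by auto. eapply trans_cross_passage; eauto.
  (* The outgoing edge of one passage is not the incoming edge of the other, as it would then join
     the vertex to itself. *)
  intros F. split; [|split; [|split]].
  - apply meet_at_ends_flip_l, meet_at_ends_flip_r, He. rewrite !Nat.mod_small; lia.
  - rewrite <- F at 1. apply (edge_simple_in_out _ _ i j W He F).
  - rewrite F. apply meet_at_ends_sym, (edge_simple_in_out _ _ j i W He). auto.
  - apply He, succ_mod_ne. lia.
Qed.

(** * Turning number as a count of jumps of the argument *)

Definition step (P : nat -> pt) (i : nat) : pt := vsub (P (S i)) (P i).

Definition jumps (k : nat) (P : nat -> pt) : Z :=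
  fold_right Z.add 0%Z (map (fun i => jump (step P i) (step P (S i))) (seq 0 k)).

(** The reversed incoming step is the incoming ray of the passage, so the odd jumps are the diagonal
    terms of [self_crossings]. *)
Lemma odd_jumps k P :
  Z.odd (jumps k P) = xsum k (fun q => ray_io P P q q).
Proof.
  unfold jumps. rewrite <- xlist_seq. generalize (seq 0 k). intros l.
  induction l as [|i l IH]; [reflexivity|].
  cbn [map fold_right xlist]. rewrite Z.odd_add, IH. f_equal. rewrite odd_jump.
  unfold ray_io, ray_right. rewrite eqh_refl. cbn [andb]. f_equal.
  unfold step, vsub. cbn [fst snd]. f_equal; ring.
Qed.

(** The arguments of the steps telescope around the walk and only the jumps remain. An exact
    reversal of direction is impossible because consecutive edges meet only at their ends. *)
Lemma turning_jumps k P : closed_walk k P -> edge_simple k P ->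
  fold_right Rplus 0 (map (fun i => signed_angle (step P i) (step P (S i))) (seq 0 k)) =
  2 * PI * IZR (jumps k P).
Proof.
  intros W He.
  assert (Hs : forall i, snd (step P i) <> 0).
  { intros i. unfold step; simpl. destruct W as (_ & _ & H). specialize (H i). lra. }
  assert (Ha : forall i, signed_angle (step P i) (step P (S i)) =
     arg (step P (S i)) - arg (step P i) + 2 * PI * IZR (jump (step P i) (step P (S i)))).
  { intros i. apply signed_angle_jump; auto. intros Hneg.
    assert (N := cross_nonzero _ _ _ (edge_simple_turn k P i W He)).
    assert (K := Hs i). unfold step in *. cbn [snd vsub] in *.
    intros C. apply N; [lra | nra |].
    rewrite <- Ropp_0, <- C. unfold cross, vsub; simpl. ring. }
  assert (T : forall m, fold_right Rplus 0
      (map (fun i => signed_angle (step P i) (step P (S i))) (seq 0 m)) =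
      arg (step P m) - arg (step P 0) + 2 * PI * IZR (jumps m P)).
  { assert (AppR : forall l x, fold_right Rplus 0 (l ++ [x]) = fold_right Rplus 0 l + x)
      by (intros l x; induction l as [|? ? IH]; simpl; [lra | rewrite IH; lra]).
    assert (AppZ : forall l x, fold_right Z.add 0%Z (l ++ [x]) = (fold_right Z.add 0 l + x)%Z)
      by (intros l x; induction l as [|? ? IH]; simpl; [lia | rewrite IH; lia]).
    unfold jumps. induction m as [|m IH]; [simpl; lra|].
    rewrite seq_S, !map_app. cbn [map]. rewrite AppR, AppZ, IH, plus_IZR, Ha, Nat.add_0_l. lra. }
  rewrite T. destruct (walk_period k P W) as (E0 & E1 & _).
  unfold step. rewrite E0, E1. lra.
Qed.

Lemma turning_number_generic n pos E g :
  straight_line_embedded n pos E -> heights_distinct n pos -> is_loop E g ->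
  exists t : Z, turning_sum pos g = 2 * PI * IZR t /\ xorb (Nat.odd (si pos g)) (Z.odd t) = true.
Proof.
  intros HE Hd Hg.
  assert (W := loop_closed_walk n pos E g HE Hd Hg).
  assert (He := loop_edge_simple n pos E g HE Hg).
  exists (jumps (length g) (walk_points pos g)). split.
  - exact (turning_jumps _ _ W He).
  - rewrite (odd_si n pos E g), odd_jumps by auto. apply self_crossings; eauto using loops_separated.
Qed.

(** * Reduction to vertices of distinct heights *)

(** Multiplication by the complex number 1 - s i, that is, a rotation followed by a scaling. *)
Definition similarity (s : R) (p : pt) : pt := (fst p + s * snd p, snd p - s * fst p).

Lemma vsub_similarity s p q : vsub (similarity s p) (similarity s q) = similarity s (vsub p q).
Proof. unfold vsub, similarity; simpl. f_equal; ring. Qed.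

(** Cross and dot product are both multiplied by 1 + s^2, which [atan2] does not see. *)
Lemma signed_angle_similarity s u w : signed_angle (similarity s u) (similarity s w) = signed_angle u w.
Proof.
  unfold signed_angle. rewrite <- (atan2_scale (1 + s * s) (cross u w) (dot u w)) by nra.
  f_equal; unfold cross, dot, similarity; simpl; ring.
Qed.

Lemma similarity_inj s p q : similarity s p = similarity s q -> p = q.
Proof.
  destruct p as [a b], q as [c d]. unfold similarity; simpl. intros H. injection H. intros H1 H2.
  assert ((1 + s * s) * (a - c) = 0) by nra. assert ((1 + s * s) * (b - d) = 0) by nra.
  assert (0 < 1 + s * s) by nra. f_equal; nra.
Qed.

Lemma on_segment_similarity s z p q :
  on_segment z (similarity s p) (similarity s q) -> exists y, z = similarity s y /\ on_segment y p q.
Proof.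
  intros (t & Ht & ->). eexists. split; [|exists t; split; [exact Ht | reflexivity]].
  unfold similarity; simpl. f_equal; ring.
Qed.

Lemma embedded_similarity s n pos E :
  straight_line_embedded n pos E -> straight_line_embedded n (fun v => similarity s (pos v)) E.
Proof.
  intros (H1 & H2 & H3 & H4 & H5 & H6). do 3 (split; [assumption|]). split; [|split].
  - intros x y Hx Hy K. apply similarity_inj in K. auto.
  - intros v a b Hv Hab K. destruct (on_segment_similarity _ _ _ _ K) as (y & Ey & Hy).
    apply similarity_inj in Ey. subst y. eauto.
  - intros a b c d z Hab Hcd N Hz Hz'.
    destruct (on_segment_similarity _ _ _ _ Hz) as (y & -> & Hy).
    destruct (on_segment_similarity _ _ _ _ Hz') as (y' & Ey & Hy'). apply similarity_inj in Ey. subst y'.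
    destruct (H6 a b c d y Hab Hcd N Hy Hy') as [[->| ->] [K|K]]; rewrite K; auto.
Qed.

Lemma turning_sum_similarity s pos g : turning_sum (fun v => similarity s (pos v)) g = turning_sum pos g.
Proof.
  unfold turning_sum. f_equal. apply map_ext. intros i.
  rewrite !vsub_similarity. apply signed_angle_similarity.
Qed.

Lemma trans_cross_similarity s pos t u :
  trans_cross (fun v => similarity s (pos v)) t u = trans_cross pos t u.
Proof.
  destruct t as [v [a b]], u as [w [c d]]. unfold trans_cross, cyc4, ccw_between, ccw_angle.
  rewrite !vsub_similarity, !signed_angle_similarity. reflexivity.
Qed.

Lemma si_similarity s pos g : si (fun v => similarity s (pos v)) g = si pos g.
Proof.
  unfold si. f_equal. apply filter_ext. intros [i j]. rewrite trans_cross_similarity. reflexivity.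
Qed.

Lemma mi_similarity s pos g h : mi (fun v => similarity s (pos v)) g h = mi pos g h.
Proof.
  unfold mi. f_equal. apply filter_ext. intros [i j]. rewrite trans_cross_similarity. reflexivity.
Qed.

Lemma upper_bound_list (l : list R) : exists s, forall x, In x l -> x < s.
Proof.
  induction l as [|a l (s & Hs)].
  - exists 0. simpl. tauto.
  - exists (Rmax s (a + 1)). intros x [<-|Hx].
    + apply Rlt_le_trans with (a + 1); [lra | apply Rmax_r].
    + apply Rlt_le_trans with s; auto using Rmax_l.
Qed.

(** Two points with different abscissae get equal heights only if [s] is the slope of the line
    joining them, so any [s] above the finitely many slopes works. With equal abscissae, equal new
    heights already make the points equal. *)
Lemma generic_similarity n (pos : nat -> pt) :
  (forall x y, (x < n)%nat -> (y < n)%nat -> pos x = pos y -> x = y) ->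
  exists s, heights_distinct n (fun v => similarity s (pos v)).
Proof.
  intros Hi.
  destruct (upper_bound_list (map (fun p =>
    (snd (pos (fst p)) - snd (pos (snd p))) / (fst (pos (fst p)) - fst (pos (snd p))))
    (list_prod (seq 0 n) (seq 0 n)))) as (s & Hs).
  exists s. intros v w Hv Hw K. simpl in K. apply Hi; auto.
  destruct (Req_dec (fst (pos v)) (fst (pos w))) as [F|F].
  - destruct (pos v), (pos w); simpl in *. subst. f_equal. lra.
  - exfalso. apply (Rlt_irrefl s).
    replace s with ((snd (pos v) - snd (pos w)) / (fst (pos v) - fst (pos w))) at 1.
    + apply Hs. apply (in_map (fun p =>
    (snd (pos (fst p)) - snd (pos (snd p))) / (fst (pos (fst p)) - fst (pos (snd p)))) _ (v, w)).
      apply in_prod; apply in_seq; lia.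
    + apply (Rmult_eq_reg_r (fst (pos v) - fst (pos w))); [|lra]. field_simplify; lra.
Qed.

Lemma turning_number_si n pos E g :
  straight_line_embedded n pos E -> is_loop E g ->
  exists t : Z, turning_sum pos g = 2 * PI * IZR t /\ xorb (Nat.odd (si pos g)) (Z.odd t) = true.
Proof.
  intros HE Hg. destruct (generic_similarity n pos) as (s & Hs); [apply HE|].
  destruct (turning_number_generic n _ E g (embedded_similarity s n pos E HE) Hs Hg) as (t & Ht).
  rewrite turning_sum_similarity, si_similarity in Ht. eauto.
Qed.

Lemma mi_even n pos E g h :
  straight_line_embedded n pos E -> is_loop E g -> is_loop E h ->
  (forall e, In e (loop_edges g) -> ~ In e (loop_edges h)) ->
  Nat.odd (mi pos g h) = false.
Proof.
  intros HE Hg Hh N. destruct (generic_similarity n pos) as (s & Hs); [apply HE|].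
  rewrite <- (mi_similarity s). eapply odd_mi; eauto using embedded_similarity.
Qed.

(** * Signs and weight products *)

Lemma pow_neg1_odd m : (-1) ^ m = if Nat.odd m then -1 else 1.
Proof.
  induction m as [|m IH]; [reflexivity|].
  simpl pow. rewrite IH, Nat.odd_succ, <- Nat.negb_odd. destruct (Nat.odd m); simpl; ring.
Qed.

Lemma powerRZ_neg1_odd z : powerRZ (-1) z = if Z.odd z then -1 else 1.
Proof.
  destruct z as [|p|p]; simpl.
  - reflexivity.
  - rewrite pow_neg1_odd. destruct p as [p|p|]; [| |reflexivity].
    + rewrite Pos2Nat.inj_xI, Nat.odd_succ, Nat.even_mul. reflexivity.
    + rewrite Pos2Nat.inj_xO, Nat.odd_mul. reflexivity.
  - rewrite pow_neg1_odd. destruct p as [p|p|]; simpl.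
    + rewrite Pos2Nat.inj_xI, Nat.odd_succ, Nat.even_mul. simpl. lra.
    + rewrite Pos2Nat.inj_xO, Nat.odd_mul. simpl. lra.
    + unfold Pos.to_nat. simpl. lra.
Qed.

Lemma pow_si_turning m t :
  xorb (Nat.odd m) (Z.odd t) = true -> (-1) ^ m = powerRZ (-1) (t + 1).
Proof.
  rewrite pow_neg1_odd, powerRZ_neg1_odd, Z.odd_add.
  destruct (Nat.odd m), (Z.odd t); simpl; congruence.
Qed.

Lemma Rprod_app l l' : Rprod (l ++ l') = Rprod l * Rprod l'.
Proof. unfold Rprod. induction l as [|a l IH]; simpl; [ring | rewrite IH; ring]. Qed.

Lemma Rprod_one {A} (f : A -> R) l : (forall x, In x l -> f x = 1) -> Rprod (map f l) = 1.
Proof.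
  unfold Rprod. induction l as [|a l IH]; intros H; simpl; [reflexivity|].
  rewrite H by (simpl; auto). rewrite IH by (intros; apply H; simpl; auto). ring.
Qed.

Lemma pairwise_edge_disjoint_tl C Cs :
  pairwise_edge_disjoint (C :: Cs) -> pairwise_edge_disjoint Cs.
Proof.
  intros H j k Hj Hk N. apply (H (S j) (S k)); simpl; lia.
Qed.

(** Each loop is edge-simple and different loops share no edge, so the concatenation has no
    duplicates to remove. *)
Lemma union_edges_concat E Cs :
  (forall C, In C Cs -> is_loop E C) -> pairwise_edge_disjoint Cs ->
  union_edges Cs = flat_map loop_edges Cs.
Proof.
  intros HL HD. apply nodup_fixed_point. induction Cs as [|C Cs IH]; simpl; [constructor|].
  apply NoDup_app.
  - apply (HL C). simpl; auto.
  - apply IH; [intros; apply HL; simpl; auto | eapply pairwise_edge_disjoint_tl; eauto].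
  - intros e He Hf. apply in_flat_map in Hf. destruct Hf as (D & HDin & Hf).
    destruct (In_nth _ _ [] HDin) as (m & Hm & Em).
    apply (HD 0%nat (S m)) with e; simpl; try lia; auto. rewrite Em. exact Hf.
Qed.

Lemma loop_products pos K Cs taus :
  Forall2 (fun C t => turning_sum pos C = 2 * PI * IZR t /\
                      xorb (Nat.odd (si pos C)) (Z.odd t) = true) Cs taus ->
  Rprod (map (fun C => (-1) ^ si pos C) Cs) * weight_prod K (flat_map loop_edges Cs) =
  Rprod (map (fun j => powerRZ (-1) (nth j taus 0%Z + 1) * weight_prod K (loop_edges (nth j Cs [])))
             (seq 0 (length Cs))).
Proof.
  induction 1 as [|C t Cs taus (_ & Ht) _ IH]; [unfold weight_prod, Rprod; simpl; ring|].
  cbn [length seq]. rewrite <- seq_shift. cbn [map]. rewrite map_map. cbn [nth].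
  cbn [flat_map]. unfold weight_prod in *. rewrite map_app, Rprod_app.
  unfold Rprod in IH |- *. cbn [fold_right]. rewrite <- IH, (pow_si_turning _ _ Ht). ring.
Qed.

Theorem mainTheorem7 (n : nat) (pos : nat -> R * R) (E : nat -> nat -> Prop)
    (K : nat -> nat -> R) (Cs : list (list nat)) :
  straight_line_embedded n pos E ->
  (forall C, In C Cs -> is_loop E C) ->
  pairwise_edge_disjoint Cs ->
  exists taus : list Z,
    length taus = length Cs /\
    (forall j, (j < length Cs)%nat ->
        turning_sum pos (nth j Cs []) = 2 * PI * IZR (nth j taus 0%Z)) /\
    Rprod (map (fun C => (-1) ^ si pos C) Cs) *
    Rprod (map (fun jk => if Nat.ltb (fst jk) (snd jk)
                          then (-1) ^ mi pos (nth (fst jk) Cs []) (nth (snd jk) Cs [])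
                          else 1)
               (list_prod (seq 0 (length Cs)) (seq 0 (length Cs)))) *
    weight_prod K (union_edges Cs)
    =
    Rprod (map (fun j => powerRZ (-1) (nth j taus 0%Z + 1) *
                         weight_prod K (loop_edges (nth j Cs [])))
               (seq 0 (length Cs))).
Proof.
  intros HE HL HD.
  (* The witnesses are integer lifts of the turning numbers, collected loop by loop together with
     their parity relation to [si]. *)
  assert (X : exists taus, Forall2 (fun C t => turning_sum pos C = 2 * PI * IZR t /\
                      xorb (Nat.odd (si pos C)) (Z.odd t) = true) Cs taus).
  { clear HD. induction Cs as [|C Cs IH]; [exists []; constructor|].
    destruct IH as (taus & HF); [intros; apply HL; simpl; auto|].
    destruct (turning_number_si n pos E C HE) as (t & Ht); [apply HL; simpl; auto|].
    exists (t :: taus). constructor; auto. }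
  destruct X as (taus & HF). exists taus. split; [|split].
  - symmetry. eapply Forall2_length; eauto.
  - clear - HF. induction HF as [|C t Cs taus (Ht & _) HF IH]; simpl; intros j Hj; [lia|].
    destruct j; auto. apply IH. lia.
  (* Every mutual factor is 1, since [mi] is even for edge-disjoint loops; the rest is a product
     over single loops. *)
  - rewrite (Rprod_one (fun jk : nat * nat => if Nat.ltb (fst jk) (snd jk) then _ else _)).
    + rewrite Rmult_1_r, (union_edges_concat E) by auto.
      exact (loop_products pos K Cs taus HF).
    + intros [j k] Hjk. apply in_prod_iff in Hjk. rewrite !in_seq in Hjk. cbn [fst snd].
      destruct (Nat.ltb_spec j k); [|reflexivity].
      rewrite pow_neg1_odd, (mi_even n pos E); auto.
      * apply HL, nth_In. lia.
      * apply HL, nth_In. lia.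
      * apply HD; lia.
Qed.
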